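(* Let $k\in C^2(\mathbb T)$, let $K:M(\mathbb T)\to L^2(\mathbb T)$ be $Ku(s)=\int_{\mathbb T}k(x-s)\,du(x)$, and let $G=\|\cdot\|_{M(\mathbb T)}$ be the total variation norm. Let $u_0=\sum_{i=1}^n c_0^i\sigma_i\delta_{x_0^i}\in M(\mathbb T)$ with $c_0^i>0$, $\sigma_i\in\{-1,1\}$, $x_0^i\in\mathbb T$, and let $y_0=Ku_0$. Suppose that 1. $\mathrm{Im}\,K_*\cap\partial G(u_0)\neq\emptyset$; 2. for $\sigma\in\{-1,1\}$ and $x\in\mathbb T$, one has $\sigma\eta_0(x)=1$ if and only if $(\sigma,x)=(\sigma_i,x_0^i)$ for some $i\in\{1,\dots,n\}$; 3. $\eta_0\in C^2(\mathbb T)$ and $\sigma_i\eta_0''(x_0^i)<0$ for all $i=1,\dots,n$, where $\eta_0$ is the minimal-norm dual certificate. Assume moreover that $K(\delta_{x_0^1}),\dots,K(\delta_{x_0^n})$ are linearly independent in $L^2(\mathbb T)$. Then, for every sufficiently small $\varepsilon>0$, there exist $\alpha>0$ and $\lambda_0>0$ such that, for all $(\lambda,w)\in N_{\alpha,\lambda_0}$ with $\lambda>0$, the problem $\min_{u\in M(\mathbb T)}\frac12\|Ku-y_0-w\|_{L^2}^2+\lambda\|u\|_{M(\mathbb T)}$ has a unique solution $\tilde u_\lambda$, and it admits a unique representation $$\tilde u_\lambda=\sum_{i=1}^n\tilde c_\lambda^i\sigma_i\delta_{\tilde x_\lambda^i}$$ where $\sigma_i\delta_{\tilde x_\lambda^i}\in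 B_\varepsilon(\sigma_i\delta_{x_0^i})$, $\sigma_i\tilde\eta_\lambda(\tilde x_\lambda^i)=1$, $\tilde c_\lambda^i>0$ and $|\tilde c_\lambda^i-c_0^i|\le\varepsilon$ for all $i=1,\dots,n$.
   Context: $\mathbb T$ is the one-dimensional torus, $M(\mathbb T)$ the space of finite signed Radon measures on $\mathbb T$, regarded as the dual of $C(\mathbb T)$. The pre-adjoint $K_*:L^2(\mathbb T)\to C(\mathbb T)$ is $K_*y(s)=\int_{\mathbb T}k(s-x)y(x)\,dx$. Subdifferentials are taken in the predual: $\partial G(u)=\{\eta\in C(\mathbb T):G(u)+\int\eta\,d(v-u)\le G(v)\ \forall v\in M(\mathbb T)\}$. Minimal-norm dual certificate: $\eta_0=K_*p_0$, where $p_0$ is the solution of minimal $L^2$-norm of $\sup\{(y_0,p)_{L^2}:p\in L^2(\mathbb T),\ K_*p\in\partial G(0)\}$ (a solution exists under hypothesis 1). For $\lambda>0$ and noise $w\in L^2(\mathbb T)$, $\tilde\eta_\lambda=K_*\tilde p_\lambda$ where $\tilde p_\lambda$ is the unique maximizer of $\lambda(y_0+w,p)-\frac{\lambda^2}2\|p\|^2_{L^2}$ over $\{p:K_*p\in\partial G(0)\}$. $N_{\alpha,\lambda_0}=\{(\lambda,w)\in\mathbb R_+\times L^2(\mathbb T):0\le\lambda\le\lambda_0,\ \|w\|_{L^2}\le\alpha\lambda\}$. $\mathcal B=\{\sigma\delta_x:x\in\mathbb T,\sigma\in\{-1,1\}\}$ is the (weak* closed) set of extreme points of the unit ball of $M(\mathbb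 T)$, $d_{\mathcal B}$ is a metric on $\mathcal B$ metrizing weak* convergence, and $B_\varepsilon(v)=\{u\in\mathcal B:d_{\mathcal B}(u,v)\le\varepsilon\}$. *)

(* Defs.v *)
From HB Require Import structures.
From mathcomp Require Import all_boot all_order all_algebra.
From mathcomp Require Import all_classical all_reals all_analysis.

Set Implicit Arguments.
Unset Strict Implicit.
Unset Printing Implicit Defensive.

Import Order.TTheory GRing.Theory Num.Theory.
Import numFieldNormedType.Exports.

Local Open Scope classical_set_scope.
Local Open Scope ring_scope.
Local Open Scope quotient_scope.

Definition integers (R : realType) : {pred R} := fun x => x \is a Num.int.

Fact integers_zmod_closed (R : realType) : GRing.zmod_closed (@integers R).
Proof. by split=> [|x y]; [exact: int_num0 | exact: rpredB]. Qed.

HB.instance Definition _ (R : realType) :=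
  GRing.isZmodClosed.Build R (@integers R) (@integers_zmod_closed R).

(* The torus is R / Z, with the quotient group structure, the quotient
   topology and the Borel sigma-algebra. *)
Definition torus (R : realType) : Type := Quotient.quot (@integers R).

HB.instance Definition _ (R : realType) := GRing.Zmodule.on (torus R).
HB.instance Definition _ (R : realType) := EqQuotient.on (torus R).

Definition torus_pi (R : realType) : R -> torus R := \pi_(torus R).

Section torus_topology.
Variable R : realType.

Definition torus_open (U : set (torus R)) := open (@torus_pi R @^-1` U).

Let torus_openT : torus_open setT.
Proof. by rewrite /torus_open preimage_setT; exact: openT. Qed.

Let torus_openI : setI_closed torus_open.
Proof. by move=> A B; exact: openI. Qed.

Let torus_open_bigU (I : Type) (f : I -> set (torus R)) :
  (forall i, torus_open (f i)) -> torus_open (\bigcup_i f i).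
Proof. by move=> fo; apply: bigcup_open => i _; exact: fo. Qed.

HB.instance Definition _ :=
  isOpenTopological.Build (torus R) torus_openT torus_openI torus_open_bigU.

End torus_topology.

HB.instance Definition _ (R : realType) := isPointed.Build (torus R) 0.
HB.instance Definition _ (R : realType) :=
  Measurable.copy (torus R) (g_sigma_algebraType (@open (torus R))).

Lemma torus_pi_continuous (R : realType) : continuous (@torus_pi R).
Proof. exact/continuousP. Qed.

Lemma measurable_torus_pi (R : realType) :
  measurable_fun [set: measurableTypeR R] (@torus_pi R).
Proof.
apply: (@measurability _ _ _ _ _ _ (@open (torus R))) => //.
move=> _ [B oB <-]; rewrite setTI; apply: measurable_realfun.open_measurable.
by move/continuousP: (@torus_pi_continuous R); exact.
Qed.

Section haar.
Variable R : realType.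

(* Total mass 1: the image of Lebesgue measure on the fundamental domain. *)
Definition haar : set (torus R) -> \bar R :=
  pushforward (mrestr lebesgue_measure (measurable_itv `[0%R, 1%R[))
              (@torus_pi R).

Let haar0 : haar set0 = 0%E.
Proof. by rewrite /haar /pushforward preimage_set0 measure0. Qed.

Let haar_ge0 A : (0 <= haar A)%E.
Proof. by rewrite /haar /pushforward; exact: measure_ge0. Qed.

Let haar_sigma_additive : semi_sigma_additive haar.
Proof.
exact: (@measure_semi_sigma_additive _ _ _
  (measure_function_pushforward__canonical__measure_function_Measure
     (mrestr lebesgue_measure (measurable_itv `[0%R, 1%R[))
     (@measurable_torus_pi R))).
Qed.

HB.instance Definition _ :=
  isMeasure.Build _ _ _ haar haar0 haar_ge0 haar_sigma_additive.

Let haar_setT : haar [set: torus R] = 1%E.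
Proof.
rewrite /haar /pushforward preimage_setT /mrestr setTI.
by rewrite lebesgue_measure_itv/= lte_fin ltr01 oppr0 adde0.
Qed.

HB.instance Definition _ :=
  Measure_isProbability.Build _ _ _ haar haar_setT.

End haar.
Arguments haar : clear implicits.

(* M(T): on the compact metrizable torus every finite signed Borel measure is
   Radon. *)
Notation radon R := (charge (torus R) R).

Section signed_measures.
Variable R : realType.
Implicit Types (u v : radon R) (f : torus R -> R).

(* A charge is a function on all subsets, with irrelevant values outside the
   sigma-algebra; this is the equality of M(T). *)
Definition eq_radon u v := forall A, measurable A -> u A = v A.

Definition hahn_pos u : set (torus R) := sval (cid (Hahn_decomposition u)).

Definition hahn_neg u : set (torus R) :=
  sval (cid (svalP (cid (Hahn_decomposition u)))).

Definition hahnP u : hahn_decomposition u (hahn_pos u) (hahn_neg u) :=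
  svalP (cid (svalP (cid (Hahn_decomposition u)))).

Definition tv_norm u : R := fine (charge_variation (hahnP u) [set: torus R]).

(* The Hahn decomposition is unique up to null sets, so that neither [tv_norm]
   nor [cintegral] depends on its choice. *)
Definition cintegral u f : R :=
  \int[jordan_pos (hahnP u)]_x f x - \int[jordan_neg (hahnP u)]_x f x.

Definition sdirac (s : R) (x : torus R) : radon R :=
  cscale s (charge_of_finite_measure \d_x).

Definition dirac_comb n (c s : 'I_n -> R) (x : 'I_n -> torus R) : radon R :=
  \big[(fun u v : radon R => cadd u v : radon R) / (czero : radon R)]_(i < n)
    cscale (c i) (sdirac (s i) (x i)).

Lemma dirac_combE n (c s : 'I_n -> R) (x : 'I_n -> torus R) (A : set (torus R)) :
  dirac_comb c s x A = (\sum_(i < n) (c i * s i)%:E * \d_(x i) A)%E.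
Proof.
rewrite /dirac_comb; elim/big_rec2: _ => //= i y v _ <-.
by rewrite /cadd/= /cscale/= /sdirac /cscale/= muleA -EFinM.
Qed.

Definition subdifferential (G : radon R -> R) u : set (torus R -> R) :=
  [set eta | continuous eta /\
    forall v, G u + cintegral (cadd v (copp u)) eta <= G v].

Definition weak_star_cvg (u_ : nat -> radon R) u :=
  forall f, continuous f ->
    cintegral (u_ n) f @[n --> \oo] --> cintegral u f.

Definition is_sign (s : R) := s = 1 \/ s = -1.

(* The set of extreme points of the unit ball of M(T). *)
Definition signed_diracs : set (radon R) :=
  [set u | exists s x, is_sign s /\ eq_radon u (sdirac s x)].

(* The weak* topology on [signed_diracs] is metrizable, hence determined by its
   convergent sequences. Only the values of d on [signed_diracs] matter. *)
Definition metrizes_weak_star (d : radon R -> radon R -> R) :=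
  [/\ forall u v, signed_diracs u -> signed_diracs v ->
        0 <= d u v /\ (d u v = 0 <-> eq_radon u v),
      forall u v, signed_diracs u -> signed_diracs v -> d u v = d v u,
      forall u v w, signed_diracs u -> signed_diracs v -> signed_diracs w ->
        d u w <= d u v + d v w &
      forall (u_ : nat -> radon R) u, (forall n, signed_diracs (u_ n)) -> signed_diracs u ->
        (d (u_ n) u @[n --> \oo] --> (0 : R)) <-> weak_star_cvg u_ u].

Definition dirac_ball (d : radon R -> radon R -> R) v (eps : R) :
    set (radon R) :=
  [set u | signed_diracs u /\ d u v <= eps].

End signed_measures.

Section smooth_functions.
Variable R : realType.
Implicit Type f : torus R -> R.

Definition periodic_lift f : R -> R := f \o @torus_pi R.

Definition C2_torus f :=
  [/\ forall t, derivable (periodic_lift f) t 1,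
      forall t, derivable (derive1 (periodic_lift f)) t 1 &
      continuous (derive1n 2 (periodic_lift f))].

(* The lift is periodic, so the representative of x is irrelevant. *)
Definition torus_derive2 f (x : torus R) : R := derive1n 2 (periodic_lift f) (repr x).

End smooth_functions.

Section L2.
Variable R : realType.
Implicit Types f g : torus R -> R.

(* Elements of L^2(T) are represented by functions; the statements below only
   depend on their almost everywhere classes. *)
Definition L2 : set (torus R -> R) := [set f | f \in Lfun (haar R) 2%:E].

Definition L2inner f g : R := \int[haar R]_x (f x * g x).

Definition L2norm f : R := fine ('N[haar R]_2%:E [EFin \o f])%E.

Definition L2_linearly_independent n (f : 'I_n -> torus R -> R) :=
  forall a : 'I_n -> R,
    {ae haar R, forall s, \sum_(i < n) a i * f i s = 0} -> forall i, a i = 0.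

End L2.

Section deconvolution.
Variables (R : realType) (k : torus R -> R).
Implicit Types (u : radon R) (y p w : torus R -> R).

Definition K u : torus R -> R := fun s => cintegral u (fun x => k (x - s)).

Definition Kpre y : torus R -> R := fun s => \int[haar R]_x (k (s - x) * y x).

Definition dual_feasible : set (torus R -> R) :=
  [set p | L2 p /\ subdifferential (@tv_norm R) czero (Kpre p)].

Definition dual_solution y0 : set (torus R -> R) :=
  [set p | dual_feasible p /\
    forall q, dual_feasible q -> L2inner y0 q <= L2inner y0 p].

Definition min_norm_dual_solution y0 : set (torus R -> R) :=
  [set p | dual_solution y0 p /\
    forall q, dual_solution y0 q -> L2norm p <= L2norm q].

(* [xget] picks a representative of the almost everywhere class of p_0, on
   which the certificate does not depend. *)
Definition min_norm_certificate y0 : torus R -> R :=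
  Kpre (xget (cst 0) (min_norm_dual_solution y0)).

Definition noisy_dual_objective y0 (lambda : R) w p : R :=
  lambda * L2inner (y0 \+ w) p - lambda ^+ 2 / 2 * L2norm p ^+ 2.

Definition noisy_dual_solution y0 (lambda : R) w : set (torus R -> R) :=
  [set p | dual_feasible p /\ forall q, dual_feasible q ->
    noisy_dual_objective y0 lambda w q <= noisy_dual_objective y0 lambda w p].

Definition noisy_certificate y0 (lambda : R) w : torus R -> R :=
  Kpre (xget (cst 0) (noisy_dual_solution y0 lambda w)).

Definition noise_region (alpha lambda0 : R) : set (R * (torus R -> R)) :=
  [set z | [/\ 0 <= z.1 <= lambda0, L2 z.2 & L2norm z.2 <= alpha * z.1]].

Definition primal_objective y0 (lambda : R) w u : R :=
  2^-1 * L2norm (K u \- y0 \- w) ^+ 2 + lambda * tv_norm u.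

Definition primal_solution y0 (lambda : R) w : set (radon R) :=
  [set u | forall v,
    primal_objective y0 lambda w u <= primal_objective y0 lambda w v].

End deconvolution.

(* Main.v *)
Require Import Defs.
From HB Require Import structures.
From mathcomp Require Import all_boot all_order all_algebra.
From mathcomp Require Import all_classical all_reals all_analysis.
From mathcomp Require Import measurable_realfun ring lra.

Set Implicit Arguments.
Unset Strict Implicit.
Unset Printing Implicit Defensive.

Import Order.TTheory GRing.Theory Num.Theory.
Import numFieldNormedType.Exports.

Local Open Scope classical_set_scope.
Local Open Scope ring_scope.

(** The proof replaces duality for the infinite-dimensional problem by a
   minimization over finitely many amplitudes and positions, and certifies the
   result afterwards.

   Write [f = y0 + w].  If a comb [u] with signs [sigma] satisfies
   [f - K u = lambda p] with [|K_* p| <= 1], with equality exactly at the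
   points of [u] and with the right signs there, then convexity does the rest:
   [u] minimizes the primal objective, any other minimizer has the same image
   and lives on the same points, hence equals [u] as soon as the atoms
   [k (x_i - .)] are independent, and [p] is the dual maximizer
   ([primal_objective_gap], [certified_primal_unique],
   [certified_noisy_certificate]).  So it suffices to produce such a comb near
   [u0].

   Take a minimizer of the objective over combs whose amplitudes and positions
   stay in a small box around those of [u0], which exists by compactness
   ([box_minimizer]), and let [p] be its residual divided by [lambda].  If the
   minimizer is in the interior of the box, stationarity says that [K_* p]
   takes the values [sigma_i] at the points and has zero derivative there
   ([interior_amplitude], [interior_position]).  If moreover [p] is close to
   the minimal-norm dual solution [p0] in L^2, then [K_* p] is close to [eta0]
   together with its second-order expansion, so that the strict curvature of
   [eta0] at the spikes and its distance to 1 elsewhere make [K_* p] an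
   admissible certificate touching 1 in modulus only at the points of the comb
   ([perturbed_certificate]).  The same closeness puts the minimizer inside the
   box: in the positions because [sigma_i eta0] is below 1 on the boundary, in
   the amplitudes because the atoms at nearby points are uniformly independent
   ([perturbed_independence]).

   It remains to see that [p] is close to [p0] ([residual_close]).  A
   component of [p0] orthogonal to the atoms and to their derivatives at the
   spikes could be shortened without leaving the dual solutions, against the
   minimality of the norm; hence [p0] lies in the span of these functions
   ([min_norm_span]).  Its coefficients tell how to
   shift the amplitudes and the positions of [u0] so that the image moves by
   [- lambda p0] up to order [lambda ^ 2] ([first_order_competitor]).
   Comparing the minimizer with this competitor, and completing the square
   around [lambda p0], bounds the distance of [p] to [p0] by the noise-to-lambda
   ratio and a power of [lambda]. *)

(** * The torus *)

Section torus.
Variable R : realType.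
Implicit Types (s t : R) (x y : torus R) (f : torus R -> R).

Lemma torus_piD s t : torus_pi (s + t) = torus_pi s + torus_pi t.
Proof. exact: raddfD. Qed.

Lemma torus_piB s t : torus_pi (s - t) = torus_pi s - torus_pi t.
Proof. exact: raddfB. Qed.

Lemma torus_pi0 : torus_pi (0 : R) = 0.
Proof. exact: raddf0. Qed.

Lemma torus_pi_repr x : torus_pi (repr x) = x.
Proof. exact: reprK. Qed.

Lemma torus_piP s t : torus_pi s = torus_pi t <-> s - t \is a Num.int.
Proof.
have -> : (s - t \is a Num.int) = (torus_pi s == torus_pi t :> torus R).
  exact: (Quotient.idealrBE (@integers R) s t).
by split=> [/eqP|/eqP].
Qed.

Lemma torus_continuous f : continuous (periodic_lift f) -> continuous f.
Proof.
by move=> /continuousP fc; apply/continuousP => A oA; exact: (fc A oA).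
Qed.

Lemma continuous_lift f : continuous f -> continuous (periodic_lift f).
Proof.
move=> fc t; apply: continuous_comp; first exact: torus_pi_continuous.
exact: fc.
Qed.

Lemma lipschitz_torus_continuous f (C : R) :
  (forall x t, `|f (x + torus_pi t) - f x| <= C * `|t|) -> continuous f.
Proof.
move=> fC; apply: torus_continuous => t.
apply/cvgrPdist_lt => e e0; near=> s.
rewrite /periodic_lift/= -(subrK t s) (addrC (s - t)) torus_piD distrC.
apply: le_lt_trans (fC _ _) _.
apply: (@le_lt_trans _ _ ((`|C| + 1) * `|s - t|)).
  by apply: ler_wpM2r => //; rewrite (le_trans (ler_norm _))// lerDl.
rewrite mulrC -ltr_pdivlMr; last by rewrite ltr_wpDl.
rewrite distrC; near: s; apply: cvgr_dist_lt => //.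
by rewrite divr_gt0// ltr_wpDl.
Unshelve. all: by end_near. Qed.

(** The representative of a class in [0, 1). *)
Definition frac t : R := t - (Num.floor t)%:~R.

Lemma frac_itv t : 0 <= frac t < 1.
Proof.
by rewrite /frac subr_ge0 floor_le/= ltrBlDr addrC -intrD1 floorD1_gt.
Qed.

Lemma torus_pi_frac t : torus_pi (frac t) = torus_pi t.
Proof. by apply/torus_piP; rewrite /frac addrAC subrr sub0r rpredN intr_int. Qed.

Lemma torus_pi_eq_frac s t : torus_pi s = torus_pi t -> frac s = frac t.
Proof.
move/torus_piP => /intrP[m e]; have -> : s = t + m%:~R by rewrite -e addrC subrK.
by rewrite /frac floorDrz// intrKfloor intrD opprD addrACA subrr addr0.
Qed.

Lemma torus_frac_ind (P : torus R -> Prop) :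
  (forall t, 0 <= t <= 1 -> P (torus_pi t)) -> forall x, P x.
Proof.
move=> P01 x; rewrite -(torus_pi_repr x) -torus_pi_frac; apply: P01.
by have /andP[-> /ltW] := frac_itv (repr x).
Qed.

Lemma continuous_torus_bounded f : continuous f -> exists B, forall x, `|f x| <= B.
Proof.
move=> fc.
have [|c _ cmax] := @EVT_max R (fun t => `|periodic_lift f t|) 0 1 ler01.
  apply: continuous_subspaceT => t.
  apply: (@continuous_comp _ _ _ (periodic_lift f) (fun s => `|s|)).
    exact: continuous_lift.
  exact: norm_continuous.
exists `|periodic_lift f c|; apply: torus_frac_ind => t t01.
by apply: cmax; rewrite in_itv.
Qed.

Lemma continuous_torus_measurable f : continuous f -> measurable_fun setT f.
Proof.
move=> /continuousP fc.
apply: (measurability _ (RGenOInfty.measurableE R)) => //.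
move=> _ [_ [a ->] <-]; rewrite setTI; apply: sub_sigma_algebra.
by apply: fc; by apply: interval_open.
Qed.

(** The quotient map has a Borel section: superlevel sets of [frac] are open
   on the line because [frac] only jumps downwards. *)
Lemma measurable_torus_frac :
  measurable_fun [set: torus R] (fun x => frac (repr x) : measurableTypeR R).
Proof.
apply: (measurability _ (RGenOInfty.measurableE R)) => //.
move=> _ [_ [a ->] <-]; rewrite setTI; have [a0|a0] := ltP a 0.
  rewrite (_ : _ @^-1` _ = setT); first exact: measurableT.
  apply/seteqP; split => // x _ /=; rewrite in_itv/= andbT (lt_le_trans a0)//.
  by case/andP: (frac_itv (repr x)).
apply: sub_sigma_algebra; rewrite /= /open/= /torus_open.
rewrite (_ : _ @^-1` _ = [set t | a < frac t]); last first.
  apply/seteqP; split=> t /=; rewrite in_itv/= andbT;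
    by rewrite (@torus_pi_eq_frac (repr (torus_pi t)) t)// torus_pi_repr.
rewrite openE => t /= at_.
have nt : t \in `](Num.floor t)%:~R + a, (Num.floor t + 1)%:~R[.
  by rewrite in_itv/= floorD1_gt andbT -ltrBrDl.
apply: (filterS _ (near_in_itvoo nt)) => s; rewrite /= in_itv/= => /andP[s1 s2].
rewrite /frac (@floor_def _ s (Num.floor t)) ?ltrBrDl// s2 andbT ltW//.
by rewrite (le_lt_trans _ s1)// lerDl.
Qed.

Lemma measurable_torus1 x : measurable [set x].
Proof.
rewrite (_ : [set x] = setT `&` (fun y => frac (repr y)) @^-1` [set frac (repr x)]).
  by apply: measurable_torus_frac => //; exact: measurable_set1.
rewrite setTI; apply/seteqP; split=> [y -> //|y /= xy].
by rewrite -(torus_pi_repr y) -torus_pi_frac xy torus_pi_frac torus_pi_repr.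
Qed.

(** Composing with the section reduces joint measurability on the product of
   two tori to that of a Borel function of two reals. *)
Lemma measurable_difference f : continuous f ->
  measurable_fun [set: torus R * torus R] (fun z => f (z.1 - z.2)).
Proof.
move=> fc.
rewrite (_ : (fun z => _) = periodic_lift f \o
    (fun z => frac (repr z.1) - frac (repr z.2))); last first.
  by apply/funext => z /=; rewrite /periodic_lift/= torus_piB !torus_pi_frac !torus_pi_repr.
apply: measurableT_comp.
  by apply: continuous_measurable_fun; exact: continuous_lift.
apply: measurable_funB.
  by apply: (measurableT_comp measurable_torus_frac); exact: measurable_fst.
by apply: (measurableT_comp measurable_torus_frac); exact: measurable_snd.
Qed.

Lemma open_arc x (r : R) :
  open [set t | exists2 s, `|s| < r & torus_pi t = x + torus_pi s].
Proof.
rewrite openE => t /= [s sr ts].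
have : \forall t' \near t, `|t - t'| < r - `|s| 
  by apply: (@cvgr_dist_lt _ _ _ (nbhs t) _ id t) => //; rewrite subr_gt0.
apply: filterS => t' tt'; exists (s + (t' - t)).
  by rewrite (le_lt_trans (ler_normD _ _))// addrC -ltrBrDr distrC.
by rewrite torus_piD addrA -ts -torus_piD addrC subrK.
Qed.

End torus.

(** * Second-order expansions on the torus *)

Section taylor.
Variable R : realType.
Implicit Types (f : torus R -> R) (g : R -> R).

(** The last clause says that [c] is on the same side of [a] as [b], so that
   second-order signs can be read off without ordering [a] and [b]. *)
Lemma mvt_between g (g1 : R -> R) (a b : R) :
  (forall t : R, is_derive t 1 g (g1 t)) ->
  exists c, [/\ g b - g a = g1 c * (b - a), `|c - a| <= `|b - a| &
             0 <= (c - a) * (b - a)].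
Proof.
move=> dg; have gc : continuous g.
  by move=> t; apply: differentiable_continuous; apply/derivable1_diffP; exact: ex_derive.
have [ab|/ltW ba] := leP a b.
  have [c] := MVT_segment ab (fun t _ => dg t) (continuous_subspaceT gc).
  rewrite in_itv/= => /andP[ac cb] e; exists c; split => //.
  - by rewrite !ger0_norm ?subr_ge0// lerD2r.
  - by rewrite mulr_ge0 ?subr_ge0.
have [c] := MVT_segment ba (fun t _ => dg t) (continuous_subspaceT gc).
rewrite in_itv/= => /andP[ac cb] e; exists c; split.
- by rewrite -opprB e -mulrN opprB.
- by rewrite !ler0_norm ?subr_le0// lerN2 lerD2r.
- by rewrite mulr_le0 ?subr_le0.
Qed.

Lemma taylor2_bound g (g1 g2 : R -> R) (B : R) :
  (forall t : R, is_derive t 1 g (g1 t)) -> (forall t : R, is_derive t 1 g1 (g2 t)) ->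
  (forall t, `|g2 t| <= B) ->
  forall t h, `|g (t + h) - g t - h * g1 t| <= B * h ^+ 2.
Proof.
move=> dg dg1 gB t h.
have [c [e ct _]] := mvt_between t (t + h) dg.
have [d [e' _ _]] := mvt_between t c dg1.
have th : t + h - t = h by ring.
rewrite th in e ct; rewrite e [X in `|X|](_ : _ = g2 d * ((c - t) * h)); last first.
  by rewrite mulrA -e'; ring.
rewrite !normrM -(real_normK (num_real h)) expr2.
by rewrite ler_pM ?mulr_ge0// ler_wpM2r.
Qed.

Lemma taylor2_concave g (g1 g2 : R -> R) (a b : R) :
  (forall t : R, is_derive t 1 g (g1 t)) -> (forall t : R, is_derive t 1 g1 (g2 t)) ->
  (forall t, `|t - a| <= `|b - a| -> g2 t <= 0) ->
  g b <= g a + (b - a) * g1 a.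
Proof.
move=> dg dg1 g20.
have [c [e ca cab]] := mvt_between a b dg.
have [d [e' da _]] := mvt_between a c dg1.
rewrite -lerBlDl e -subr_le0 [leLHS](_ : _ = (g1 c - g1 a) * (b - a)); last by ring.
by rewrite e' -mulrA mulr_le0_ge0// g20// (le_trans da).
Qed.

Lemma derive1_periodic g (c : R) : (forall t, g (t + c) = g t) ->
  forall t, derive1 g (t + c) = derive1 g t.
Proof.
move=> gc t; rewrite /derive1 gc.
rewrite (_ : (fun h : R => _) = fun h => h^-1 *: (g (h + t) - g t))//.
by apply/funext => h; rewrite addrA gc.
Qed.

Lemma periodic_derive1 f (t s : R) : torus_pi s = torus_pi t ->
  derive1 (periodic_lift f) s = derive1 (periodic_lift f) t /\
  derive1n 2 (periodic_lift f) s = derive1n 2 (periodic_lift f) t.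
Proof.
move=> st.
have p1 : torus_pi (s - t) = 0 by rewrite torus_piB st subrr.
have p2 : forall u, periodic_lift f (u + (s - t)) = periodic_lift f u.
  by move=> u; rewrite /periodic_lift/= torus_piD p1 addr0.
have -> : s = t + (s - t) by rewrite addrC subrK.
split; first exact: (derive1_periodic p2).
by rewrite !derive1nS; apply: derive1_periodic; exact: derive1_periodic.
Qed.

Definition torus_derive1 f (x : torus R) : R :=
  derive1 (periodic_lift f) (repr x).

Lemma torus_derive1_lift f : periodic_lift (torus_derive1 f) = derive1 (periodic_lift f).
Proof.
apply/funext => t; apply: (proj1 (periodic_derive1 f _)).
exact: torus_pi_repr.
Qed.

Lemma torus_derive2_lift f : periodic_lift (torus_derive2 f) = derive1n 2 (periodic_lift f).
Proof.
apply/funext => t; apply: (proj2 (periodic_derive1 f _)).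
exact: torus_pi_repr.
Qed.

Lemma C2_torus_is_derive f : C2_torus f -> forall t : R,
  is_derive t 1 (periodic_lift f) (periodic_lift (torus_derive1 f) t) /\
  is_derive t 1 (periodic_lift (torus_derive1 f)) (periodic_lift (torus_derive2 f) t).
Proof.
case=> d1 d2 _ t; rewrite torus_derive1_lift torus_derive2_lift; split.
  by rewrite derive1E; apply/derivableP; exact: d1.
by rewrite derive1nS derive1n1 derive1E; apply/derivableP; exact: d2.
Qed.

Lemma C2_torus_continuous f : C2_torus f ->
  [/\ continuous f, continuous (torus_derive1 f) & continuous (torus_derive2 f)].
Proof.
move=> fC2; have df := C2_torus_is_derive fC2; split.
- apply: torus_continuous => t; apply: differentiable_continuous.
  by apply/derivable1_diffP; apply: ex_derive; exact: (proj1 (df t)).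
- apply: torus_continuous => t; apply: differentiable_continuous.
  by apply/derivable1_diffP; apply: ex_derive; exact: (proj2 (df t)).
- by apply: torus_continuous; rewrite torus_derive2_lift; case: fC2.
Qed.

(** One constant controls [f], its increments and its first-order remainder,
   which is all that is ever used of the kernel. *)
Definition expansion_bound f (B : R) :=
  [/\ 0 < B, forall x, `|f x| <= B, forall x, `|torus_derive1 f x| <= B,
      forall x h, `|f (x + torus_pi h) - f x| <= B * `|h| &
      forall x h, `|f (x + torus_pi h) - f x - h * torus_derive1 f x| <= B * h ^+ 2].

Lemma C2_torus_expansion f : C2_torus f -> exists B, expansion_bound f B.
Proof.
move=> fC2; have df := C2_torus_is_derive fC2.
have [c0 c1 c2] := C2_torus_continuous fC2.
have [B0 fB0] := continuous_torus_bounded c0.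
have [B1 fB1] := continuous_torus_bounded c1.
have [B2 fB2] := continuous_torus_bounded c2.
have B00 : 0 <= B0 by exact: le_trans (normr_ge0 _) (fB0 0).
have B10 : 0 <= B1 by exact: le_trans (normr_ge0 _) (fB1 0).
have B20 : 0 <= B2 by exact: le_trans (normr_ge0 _) (fB2 0).
exists (B0 + B1 + B2 + 1); split; first by lra.
- by move=> x; apply: le_trans (fB0 x) _; lra.
- by move=> x; apply: le_trans (fB1 x) _; lra.
- move=> x h; rewrite -(torus_pi_repr x) -torus_piD.
  have [c [e _ _]] := mvt_between (repr x) (repr x + h) (fun t => proj1 (df t)).
  rewrite [X in `|X|]e (_ : repr x + h - repr x = h); last by ring.
  rewrite normrM ler_wpM2r//; apply: (le_trans (fB1 _)); lra.
- move=> x h; rewrite -(torus_pi_repr x) -torus_piD.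
  apply: le_trans (@taylor2_bound _ _ _ B2 (fun t => proj1 (df t))
    (fun t => proj2 (df t)) (fun t => fB2 _) (repr x) h) _.
  by rewrite ler_wpM2r ?sqr_ge0//; lra.
Qed.

(** Near [x] the function [s * f + kr.1 * (t - a) ^+ 2] still has a nonpositive
   second derivative, hence lies below its tangents; [kr.2] is the radius on
   which this happens, uniformly in the point of tangency. *)
Lemma C2_torus_strict_concave f (s : R) x : C2_torus f ->
  s * torus_derive2 f x < 0 -> exists kr : R * R,
  [/\ 0 < kr.1, 0 < kr.2 & forall a b, `|a| <= kr.2 -> `|b| <= kr.2 ->
    s * f (x + torus_pi b) <= s * f (x + torus_pi a) +
      (b - a) * (s * torus_derive1 f (x + torus_pi a)) - kr.1 * (b - a) ^+ 2].
Proof.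
move=> fC2 fx; have df := C2_torus_is_derive fC2.
have [_ _ /continuous_lift c2] := C2_torus_continuous fC2.
pose t0 := repr x; pose k := - (s * torus_derive2 f x) / 4.
have k0 : 0 < k by rewrite divr_gt0// oppr_gt0.
have : \forall t \near t0, s * periodic_lift (torus_derive2 f) t < - (2 * k).
  apply: (cvgr_lt _ (@cvgMl_tmp _ _ (nbhs t0) _ _ s _ (c2 t0))).
  by rewrite /periodic_lift/= torus_pi_repr /k; lra.
move/nbhs_ballP => [r /= r0 rP].
(* both points are within [r / 4], hence everything between within [3 r / 4] *)
exists (k, r / 4); split => //=; first by rewrite divr_gt0.
move=> a b ar br; rewrite -(torus_pi_repr x) -!torus_piD.
pose g t := s * periodic_lift f t + k * (t - (t0 + a)) ^+ 2.
pose g1 t := s * periodic_lift (torus_derive1 f) t + 2 * k * (t - (t0 + a)).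
pose g2 t := s * periodic_lift (torus_derive2 f) t + 2 * k.
have dg (t : R) : is_derive t 1 g (g1 t).
  have := proj1 (df t) => ?; rewrite /g; apply: is_derive_eq.
  by rewrite /g1 /GRing.scale/=; ring.
have dg1 (t : R) : is_derive t 1 g1 (g2 t).
  have := proj2 (df t) => ?; rewrite /g1; apply: is_derive_eq.
  by rewrite /g2 /GRing.scale/=; ring.
suff : g (t0 + b) <= g (t0 + a) + (t0 + b - (t0 + a)) * g1 (t0 + a).
  rewrite /g /g1 subrr expr0n/= !mulr0 !addr0 (_ : t0 + b - (t0 + a) = b - a); last by ring.
  by rewrite /periodic_lift/= => H; rewrite lerBrDr.
apply: taylor2_concave dg dg1 _ => t ta; rewrite /g2 -lerBrDr sub0r ltW//.
apply: rP; rewrite -ball_normE/= distrC.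
move: ta ar br; rewrite (_ : t0 + b - (t0 + a) = b - a); last by ring.
have := ler_norm (t - (t0 + a)); have := ler_norm (- (t - (t0 + a))).
rewrite normrN => h1 h2 h3 h4 h5.
have := ler_normB b a => h6.
have h7 : `|t - (t0 + a)| <= r / 2 by lra.
rewrite (_ : t - t0 = t - (t0 + a) + a); last by ring.
apply: le_lt_trans (ler_normD _ _) _; lra.
Qed.

End taylor.

Lemma first_order_eq0 (R : realType) (a C r : R) : 0 < r ->
  (forall h, `|h| <= r -> 0 <= a * h + C * h ^+ 2) -> a = 0.
Proof.
move=> r0 H.
have [C' C'0 CC'] : exists2 C' : R, 0 < C' & C <= C'.
  by exists (`|C| + 1); rewrite ?ltr_wpDl// (le_trans (ler_norm _))// lerDl.
have H' h : `|h| <= r -> 0 <= a * h + C' * h ^+ 2.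
  by move=> /H /le_trans; apply; rewrite lerD2l ler_wpM2r ?sqr_ge0.
apply/eqP; rewrite -normr_le0 leNgt; apply/negP => a0.
pose t := Num.min r (`|a| / (2 * C')).
have t0 : 0 < t by rewrite lt_min r0 divr_gt0// mulr_gt0.
have tr : t <= r by rewrite ge_min lexx.
have ta : C' * t <= `|a| / 2.
  have : t <= `|a| / (2 * C') by rewrite ge_min lexx orbT.
  rewrite -(ler_pM2l C'0) => /le_trans; apply; rewrite le_eqVlt; apply/orP; left.
  by apply/eqP; field; rewrite gt_eqF.
have := H' (- Num.sg a * t).
rewrite normrM normrN normr_sg (gtr0_norm t0).
have -> : (a != 0) by rewrite -normr_gt0.
rewrite mul1r => /(_ tr).
have -> : a * (- Num.sg a * t) = - (`|a| * t) by rewrite (normrEsg a); ring.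
have -> : (- Num.sg a * t) ^+ 2 = t ^+ 2.
  by rewrite exprMn sqrrN sqr_sg -normr_gt0 a0 mul1r.
have : C' * t * t <= `|a| / 2 * t by rewrite ler_wpM2r// ltW.
have : 0 < `|a| * t by rewrite mulr_gt0.
rewrite expr2; lra.
Qed.

(** * The inner product of square-integrable functions *)

Section L2_inner.
Variable R : realType.
Implicit Types (f g h : torus R -> R) (a : R).

Lemma haarT : haar R setT = 1%E.
Proof. exact: probability_setT. Qed.

Lemma haar_lty : (haar R setT < +oo)%E.
Proof. by rewrite haarT ltry. Qed.

Lemma L2_measurable f : L2 f -> measurable_fun setT f.
Proof. by rewrite /L2/= inE => /andP[/[!inE]]. Qed.

Lemma L2D f g : L2 f -> L2 g -> L2 (f + g).
Proof. exact: (Lfun_addr_closed (haar R) (lee1n 2)).2. Qed.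

Lemma L2Z a f : L2 f -> L2 (a *: f).
Proof.
rewrite /L2/= => L2f; rewrite (_ : a *: f = a \o* f).
  by apply: Lfun_scale => //; rewrite ler1n.
by apply/funext => x /=; rewrite mulrC.
Qed.

Lemma L20 : L2 (0 : torus R -> R).
Proof. exact: (Lfun_addr_closed (haar R) (lee1n 2)).1. Qed.

Lemma L2N f : L2 f -> L2 (- f).
Proof. by move=> L2f; rewrite -scaleN1r; exact: L2Z. Qed.

Lemma L2B f g : L2 f -> L2 g -> L2 (f - g).
Proof. by move=> L2f L2g; apply: L2D => //; exact: L2N. Qed.

Lemma L2_sum n (F : 'I_n -> torus R -> R) :
  (forall i, L2 (F i)) -> L2 (\sum_(i < n) F i).
Proof.
move=> L2F; elim/big_ind: _ => [|f g|i _]; [exact: L20|exact: L2D|exact: L2F].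
Qed.

Lemma L2_mul_integrable f g : L2 f -> L2 g ->
  (haar R).-integrable setT (EFin \o (f \* g)).
Proof. by move=> L2f L2g; apply/Lfun1_integrable; exact: Lfun2_mul_Lfun1. Qed.

Lemma L2innerC f g : L2inner f g = L2inner g f.
Proof. by rewrite /L2inner; apply: eq_Rintegral => x _; rewrite mulrC. Qed.

Lemma L2innerDl f g h : L2 f -> L2 g -> L2 h ->
  L2inner (f + g) h = L2inner f h + L2inner g h.
Proof.
move=> L2f L2g L2h; rewrite /L2inner -RintegralD//; last 2 first.
- exact: L2_mul_integrable.
- exact: L2_mul_integrable.
by apply: eq_Rintegral => x _; rewrite -mulrDl.
Qed.

Lemma L2innerZl a f h : L2 f -> L2 h -> L2inner (a *: f) h = a * L2inner f h.
Proof.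
move=> L2f L2h; rewrite /L2inner -RintegralZl//; last exact: L2_mul_integrable.
by apply: eq_Rintegral => x _; rewrite mulrA.
Qed.

Lemma L2innerNl f h : L2 f -> L2 h -> L2inner (- f) h = - L2inner f h.
Proof. by move=> L2f L2h; rewrite -scaleN1r L2innerZl// mulN1r. Qed.

Lemma L2innerBl f g h : L2 f -> L2 g -> L2 h ->
  L2inner (f - g) h = L2inner f h - L2inner g h.
Proof. by move=> L2f L2g L2h; rewrite L2innerDl ?L2innerNl//; exact: L2N. Qed.

Lemma L2inner0l h : L2inner 0 h = 0.
Proof.
rewrite /L2inner (_ : (fun _ => _) = cst 0) ?Rintegral_cst ?mul0r//.
by apply/funext => x; rewrite mul0r.
Qed.

Lemma L2inner_suml n (F : 'I_n -> torus R -> R) h : (forall i, L2 (F i)) -> L2 h ->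
  L2inner (\sum_(i < n) F i) h = \sum_(i < n) L2inner (F i) h.
Proof.
move=> L2F L2h; suff [] : L2 (\sum_(i < n) F i) /\
  L2inner (\sum_(i < n) F i) h = \sum_(i < n) L2inner (F i) h by [].
elim/big_rec2: _ => [|i y f _ [L2f <-]]; first by rewrite L2inner0l; split => //; exact: L20.
by rewrite L2innerDl//; split => //; exact: L2D.
Qed.

Lemma L2innerDr f g h : L2 f -> L2 g -> L2 h ->
  L2inner h (f + g) = L2inner h f + L2inner h g.
Proof. by move=> *; rewrite ![L2inner h _]L2innerC L2innerDl. Qed.

Lemma L2innerZr a f h : L2 f -> L2 h -> L2inner h (a *: f) = a * L2inner h f.
Proof. by move=> *; rewrite ![L2inner h _]L2innerC L2innerZl. Qed.

Lemma L2innerBr f g h : L2 f -> L2 g -> L2 h ->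
  L2inner h (f - g) = L2inner h f - L2inner h g.
Proof. by move=> *; rewrite ![L2inner h _]L2innerC L2innerBl. Qed.

Lemma L2inner_ge0 f : 0 <= L2inner f f.
Proof. by apply: Rintegral_ge0 => x _; rewrite -expr2 sqr_ge0. Qed.

Lemma L2norm_ge0 f : 0 <= L2norm f.
Proof. by rewrite /L2norm fine_ge0// Lnorm_ge0. Qed.

Lemma L2norm_sqr f : L2 f -> L2norm f ^+ 2 = L2inner f f.
Proof.
rewrite /L2/= => L2f; have := Lfun2_integrable_sqr L2f => isq.
move: L2f; rewrite inE => /andP[_]; rewrite inE/= /finite_norm => Nf.
have Nfin : ('N[haar R]_2[EFin \o f])%E \is a fin_num by rewrite ge0_fin_numE ?Lnorm_ge0.
have := @powR_Lnorm _ _ _ (haar R) (EFin \o f) 2 (negbT (pnatr_eq0 R 2)).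
rewrite -(fineK Nfin) -/(L2norm f) poweR_EFin powR_mulrn ?L2norm_ge0// => e.
apply: EFin_inj; rewrite e /L2inner /Rintegral.
rewrite fineK; last first.
  rewrite (_ : (fun x => _) = EFin \o (fun x => f x ^+ 2)).
    exact: (integrable_fin_num _ isq).
  by apply/funext => x /=; rewrite expr2.
apply: eq_integral => x _ /=.
by rewrite powR_mulrn// real_normK ?num_real// expr2.
Qed.

(** From the nonnegativity of the square of [f - t *: g] in [t]; when [g] is
   null, a suitable [t] makes the expression equal to [-1] unless the inner
   product vanishes. *)
Lemma cauchy_schwarz f g : L2 f -> L2 g ->
  `|L2inner f g| <= L2norm f * L2norm g.
Proof.
move=> L2f L2g.
have P t : 0 <= L2inner f f - 2 * t * L2inner f g + t ^+ 2 * L2inner g g.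
  have := L2inner_ge0 (f - t *: g).
  have L2t := L2Z t L2g; rewrite L2innerBl ?L2innerBr ?L2innerZl ?L2innerZr//;
    do ?[exact: L2B].
  by rewrite (L2innerC g f); congr (0 <= _); ring.
rewrite -(@ler_pXn2r _ 2)// ?nnegrE ?mulr_ge0 ?L2norm_ge0//.
rewrite real_normK ?num_real// exprMn !L2norm_sqr//.
have [g0|g0] := eqVneq (L2inner g g) 0.
  have [->|fg0] := eqVneq (L2inner f g) 0.
    by rewrite expr0n/= mulr_ge0 ?L2inner_ge0.
  have := P ((L2inner f f + 1) / (2 * L2inner f g)).
  rewrite g0 mulr0 addr0 [X in _ - X](_ : _ = L2inner f f + 1); last by field.
  lra.
have := mulr_ge0 (P (L2inner f g / L2inner g g)) (L2inner_ge0 g).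
set A := (X in _ <= X -> _); have -> : A = L2inner f f * L2inner g g - L2inner f g ^+ 2.
  by rewrite /A; field.
by rewrite subr_ge0.
Qed.

Lemma L2norm_sqrD f g : L2 f -> L2 g ->
  L2norm (f + g) ^+ 2 = L2norm f ^+ 2 + 2 * L2inner f g + L2norm g ^+ 2.
Proof.
move=> L2f L2g; rewrite !L2norm_sqr//; last exact: L2D.
rewrite L2innerDl ?L2innerDr//; last exact: L2D.
by rewrite (L2innerC g f); ring.
Qed.

Lemma L2normZ a f : L2 f -> L2norm (a *: f) = `|a| * L2norm f.
Proof.
move=> L2f; apply/eqP; rewrite -(@eqrXn2 _ 2) ?L2norm_ge0 ?mulr_ge0 ?L2norm_ge0//.
rewrite exprMn !L2norm_sqr//; last exact: L2Z.
rewrite L2innerZl ?L2innerZr//; last exact: L2Z.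
by rewrite real_normK ?num_real// mulrA expr2.
Qed.

Lemma L2normN f : L2 f -> L2norm (- f) = L2norm f.
Proof. by move=> L2f; rewrite -scaleN1r L2normZ// normrN1 mul1r. Qed.

Lemma L2norm_triangle f g : L2 f -> L2 g -> L2norm (f + g) <= L2norm f + L2norm g.
Proof.
move=> L2f L2g; rewrite -(@ler_pXn2r _ 2)// ?nnegrE ?addr_ge0 ?L2norm_ge0//.
have := le_trans (ler_norm _) (cauchy_schwarz L2f L2g).
by rewrite L2norm_sqrD// sqrrD; lra.
Qed.

Lemma L2norm_triangleB f g : L2 f -> L2 g -> L2norm (f - g) <= L2norm f + L2norm g.
Proof.
by move=> L2f L2g; rewrite -(L2normN L2g) L2norm_triangle//; exact: L2N.
Qed.

Lemma L2norm_dist f g : L2 f -> L2 g -> `|L2norm f - L2norm g| <= L2norm (f - g).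
Proof.
move=> L2f L2g.
have h1 := L2norm_triangle (L2B L2f L2g) L2g; rewrite subrK in h1.
have h2 := L2norm_triangle (L2B L2g L2f) L2f; rewrite subrK -opprB L2normN in h2; last exact: L2B.
by rewrite ler_norml lerBlDr h1 andbT lerBrDr addrC lerBlDr addrC.
Qed.

Lemma L2norm_sum n (F : 'I_n -> torus R -> R) : (forall i, L2 (F i)) ->
  L2norm (\sum_(i < n) F i) <= \sum_(i < n) L2norm (F i).
Proof.
move=> L2F; suff [] : L2 (\sum_(i < n) F i) /\
  L2norm (\sum_(i < n) F i) <= \sum_(i < n) L2norm (F i) by [].
elim/big_rec2: _ => [|i y f _ [L2f fy]].
  split; first exact: L20.
  by rewrite -(@ler_pXn2r _ 2)// ?nnegrE ?L2norm_ge0// expr0n/= L2norm_sqr ?L2inner0l//; exact: L20.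
split; first exact: L2D.
by apply: le_trans (L2norm_triangle _ _) _ => //; rewrite lerD2l.
Qed.

Lemma L2norm0_ae f : L2 f -> L2norm f = 0 -> {ae haar R, forall x, f x = 0}.
Proof.
move=> L2f; have mf := L2_measurable L2f.
have Nf : ('N[haar R]_2[EFin \o f])%E \is a fin_num.
  move: L2f; rewrite /L2/= inE => /andP[_]; rewrite inE/= /finite_norm => Nf.
  by rewrite ge0_fin_numE ?Lnorm_ge0.
rewrite /L2norm => f0.
have N0 : ('N[haar R]_2[EFin \o f] = 0)%E by rewrite -(fineK Nf) f0.
have mEf : measurable_fun setT (EFin \o f) by exact/measurable_EFinP.
have p2 : (0%R < 2%:E :> \bar R)%E by rewrite lte_fin.
have [A [mA A0 sub]] := Lnorm_eq0_eq0 mEf p2 N0.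
exists A; split => // x /= fx; apply: sub => /= H; apply: fx.
by have /= := H I => -[].
Qed.

Lemma bounded_L2 f (B : R) : measurable_fun setT f -> (forall x, `|f x| <= B) ->
  L2 f /\ L2norm f <= B.
Proof.
move=> mf fB.
have B0 : 0 <= B by exact: le_trans (normr_ge0 _) (fB 0).
have i2 : (haar R).-integrable setT (EFin \o (f \* f)).
  apply: measurable_bounded_integrable => //.
  - exact: haar_lty.
  - exact: measurable_funM.
  - exists (B ^+ 2); split => [|y By x _ /=]; first exact: num_real.
    by rewrite (le_trans _ (ltW By))// normrM expr2 ler_pM.
have Nf : (('N[haar R]_2[EFin \o f]) `^ 2 < +oo)%E.
  rewrite powR_Lnorm ?pnatr_eq0//.
  case/integrableP : i2 => _; apply: le_lt_trans.
  rewrite le_eqVlt; apply/orP; left; apply/eqP; apply: eq_integral => x _ /=.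
  by rewrite powR_mulrn// normrM expr2.
have L2f : L2 f.
  rewrite /L2/= inE; apply/andP; split; rewrite inE//= /finite_norm.
  by rewrite (@lty_poweRy _ _ 2).
split => //; rewrite -(@ler_pXn2r _ 2)// ?nnegrE ?L2norm_ge0// L2norm_sqr//.
rewrite (_ : B ^+ 2 = \int[haar R]_x (cst (B ^+ 2) x)); last first.
  by rewrite Rintegral_cst// [X in fine X]haarT /= mulr1.
apply: le_Rintegral => // [|x _ /=].
  apply: measurable_bounded_integrable => //.
    exact: haar_lty.
  exists (B ^+ 2); split => [|y By x _ /=]; first exact: num_real.
  by rewrite ger0_norm ?sqr_ge0// ltW.
by rewrite -expr2 -(real_normK (num_real (f x))) ler_pXn2r ?nnegrE.
Qed.

Lemma continuous_L2 f : continuous f -> L2 f.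
Proof.
move=> fc; have [B fB] := continuous_torus_bounded fc.
exact: (bounded_L2 (continuous_torus_measurable fc) fB).1.
Qed.

End L2_inner.

(** * Finite families of square-integrable functions *)

Section L2_finite_families.
Variable R : realType.
Implicit Types (p : torus R -> R).

(** Gram-Schmidt, by induction on the family.  The part [e] of the new function
   that is orthogonal to the others may have norm zero without being zero;
   everything is then orthogonal to it by Cauchy-Schwarz. *)
Lemma L2_projection n (g : 'I_n -> torus R -> R) p :
  (forall i, L2 (g i)) -> L2 p ->
  exists a : 'I_n -> R, forall j, L2inner (p - \sum_(i < n) a i *: g i) (g j) = 0.
Proof.
elim: n g p => [|n IH] g p L2g L2p; first by exists (fun=> 0) => -[].
pose g' i := g (lift ord0 i).
have L2g' i : L2 (g' i) by exact: L2g.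
have [a pa] := IH g' p L2g' L2p.
have [b eb] := IH g' (g ord0) L2g' (L2g ord0).
have L2s (c : 'I_n -> R) : L2 (\sum_(i < n) c i *: g' i).
  by apply: L2_sum => i; exact: L2Z.
set p' := p - _ in pa; set e := g ord0 - _ in eb.
have L2p' : L2 p' by exact: L2B.
have L2e : L2 e by exact: L2B.
have [t te] : exists t, L2inner (p' - t *: e) e = 0.
  have [e0|e0] := eqVneq (L2inner e e) 0; last first.
    exists (L2inner p' e / L2inner e e).
    by rewrite L2innerBl ?L2innerZl//; [field|exact: L2Z].
  exists 0; rewrite scale0r subr0; apply/eqP; rewrite -normr_le0.
  apply: le_trans (cauchy_schwarz L2p' L2e) _.
  have : L2norm e ^+ 2 = 0 by rewrite L2norm_sqr.
  by move/eqP; rewrite sqrf_eq0 => /eqP ->; rewrite mulr0.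
pose a' i := if unlift ord0 i is Some j then a j - t * b j else t.
exists a'.
have pE : p - \sum_(i < n.+1) a' i *: g i = p' - t *: e.
  rewrite big_ord_recl /a' unlift_none.
  under eq_bigr do rewrite liftK scalerBl -scalerA.
  rewrite sumrB -scaler_sumr /p' /e -/(g' _).
  apply/funext => x; rewrite !fctE /GRing.scale/=.
  by ring.
have L2pt : L2 (p' - t *: e) by apply: L2B => //; exact: L2Z.
rewrite pE => j; case: (unliftP ord0 j) => [i ->|->].
  by rewrite L2innerBl ?L2innerZl ?pa ?eb ?mulr0 ?subrr//; exact: L2Z.
have -> : g ord0 = e + \sum_(i < n) b i *: g' i by rewrite /e subrK.
rewrite L2innerDr// te add0r L2innerC L2inner_suml//; last by move=> i; exact: L2Z.
rewrite big1// => i _; rewrite L2innerZl// L2innerC L2innerBl//; last exact: L2Z.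
by rewrite pa L2innerZl// eb mulr0 subr0 mulr0.
Qed.

(** The remainder of [g j] after projection on the other functions, rescaled;
   independence keeps its norm away from zero. *)
Lemma L2_dual_vector n (g : 'I_n -> torus R -> R) j :
  (forall i, L2 (g i)) -> L2_linearly_independent g ->
  exists2 h, L2 h & forall i, L2inner (g i) h = (i == j)%:R.
Proof.
move=> L2g gfree; pose g' i := if i == j then 0 else g i.
have L2g' i : L2 (g' i) by rewrite /g'; case: ifP => // _; exact: L20.
have [a ha] := L2_projection L2g' (L2g j).
set h := g j - _ in ha.
have L2h : L2 h by apply: L2B => //; apply: L2_sum => i; exact: L2Z.
pose b i := if i == j then 1 else - a i.
have hE : h = \sum_(i < n) b i *: g i.
  rewrite (bigD1 j)//= /b eqxx scale1r /h -sumrN; congr (_ + _).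
  rewrite (bigD1 j)//= /g' eqxx scaler0 oppr0 add0r.
  by apply: eq_bigr => i /negbTE ->; rewrite scaleNr.
have hi i : i != j -> L2inner (g i) h = 0.
  by move=> ij; have := ha i; rewrite /g' (negbTE ij) L2innerC.
have hh : L2inner h h = L2inner (g j) h.
  rewrite {1}hE L2inner_suml//; last by move=> i; exact: L2Z.
  rewrite (bigD1 j)//= /b eqxx scale1r big1 ?addr0// => i ij.
  by rewrite (negbTE ij) L2innerZl// hi// mulr0.
have hn0 : L2inner (g j) h != 0.
  apply/eqP => hj; have : L2norm h = 0.
    by apply/eqP; rewrite -sqrf_eq0 L2norm_sqr// hh hj.
  move/(L2norm0_ae L2h) => h0.
  have : b j = 0.
    apply: (gfree b); apply: filterS h0 => x.
    by rewrite hE fct_sumE.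
  by rewrite /b eqxx => /eqP; rewrite oner_eq0.
exists ((L2inner (g j) h)^-1 *: h); first exact: L2Z.
move=> i; rewrite L2innerZr//; have [->|ij] := eqVneq i j; first by rewrite mulVf.
by rewrite (hi i)// mulr0.
Qed.

(** Coefficients are read off by pairing with the dual vectors. *)
Lemma L2_independent_coef_bound n (g : 'I_n -> torus R -> R) :
  (forall i, L2 (g i)) -> L2_linearly_independent g ->
  exists2 C : R, 0 < C & forall (a : 'I_n -> R) j,
    `|a j| <= C * L2norm (\sum_(i < n) a i *: g i).
Proof.
move=> L2g gfree.
have /choice[h hP] : forall j, exists h, L2 h /\ forall i, L2inner (g i) h = (i == j)%:R.
  by move=> j; have [h ? ?] := L2_dual_vector j L2g gfree; exists h.
exists (\sum_(i < n) L2norm (h i) + 1).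
  by rewrite ltr_wpDl// sumr_ge0// => i _; exact: L2norm_ge0.
move=> a j; have [L2h hj] := hP j.
have L2a i : L2 (a i *: g i) by exact: L2Z.
have -> : a j = L2inner (\sum_(i < n) a i *: g i) (h j).
  rewrite L2inner_suml// (bigD1 j)//= L2innerZl// hj eqxx mulr1.
  rewrite big1 ?addr0// => i ij; by rewrite L2innerZl// hj (negbTE ij) mulr0.
apply: le_trans (cauchy_schwarz _ L2h) _; first exact: L2_sum.
rewrite mulrC ler_wpM2r ?L2norm_ge0// (bigD1 j)//= -addrA lerDl addr_ge0//.
by apply: sumr_ge0 => i _; exact: L2norm_ge0.
Qed.

End L2_finite_families.

(** * Signed measures *)

Section signed_measures.
Variable R : realType.
Implicit Types (u v : radon R) (f : torus R -> R) (m : {measure set (torus R) -> \bar R}).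

Local Notation pos u := (jordan_pos (hahnP u)).
Local Notation neg u := (jordan_neg (hahnP u)).

Definition bounded_measurable f :=
  measurable_fun setT f /\ exists B : R, forall x, `|f x| <= B.

Lemma continuous_bounded_measurable f : continuous f -> bounded_measurable f.
Proof.
move=> fc; split; first exact: continuous_torus_measurable.
exact: continuous_torus_bounded.
Qed.

Lemma bounded_measurable_integrable m f : (m setT < +oo)%E ->
  bounded_measurable f -> m.-integrable setT (EFin \o f).
Proof.
move=> mT [mf [B fB]]; apply: measurable_bounded_integrable => //.
exists B; split => [|y By x _ /=]; first exact: num_real.
exact: le_trans (fB x) (ltW By).
Qed.

Lemma pos_lty u : (pos u setT < +oo)%E.
Proof. by rewrite ltey_eq fin_num_measure. Qed.

Lemma neg_lty u : (neg u setT < +oo)%E.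
Proof. by rewrite ltey_eq fin_num_measure. Qed.

Lemma jordanE u A : measurable A -> u A = (pos u A - neg u A)%E.
Proof. by move=> mA; rewrite (jordan_decomp (hahnP u) mA) /cadd/= cscaleN1. Qed.

Lemma tv_normE u : tv_norm u = fine (pos u setT) + fine (neg u setT).
Proof. by rewrite /tv_norm /charge_variation fineD// fin_num_measure. Qed.

Lemma Rintegral_measure_add m1 m2 f : (m1 setT < +oo)%E -> (m2 setT < +oo)%E ->
  bounded_measurable f ->
  \int[measure_add m1 m2]_x f x = \int[m1]_x f x + \int[m2]_x f x.
Proof.
move=> m1T m2T bf.
have i1 := bounded_measurable_integrable m1T bf.
have i2 := bounded_measurable_integrable m2T bf.
rewrite /Rintegral integral_measure_add// fineD//; exact: integrable_fin_num.
Qed.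

Lemma Rintegral_mscale m f (a : {nonneg R}) : (m setT < +oo)%E ->
  bounded_measurable f -> \int[mscale a m]_x f x = a%:num * \int[m]_x f x.
Proof.
move=> mT bf; have i1 := bounded_measurable_integrable mT bf.
have mf : measurable_fun setT (EFin \o f) by exact: measurable_int i1.
have ip := integrable_fin_num measurableT (integrable_funepos measurableT i1).
have iN := integrable_fin_num measurableT (integrable_funeneg measurableT i1).
rewrite /Rintegral integralE [in RHS]integralE.
rewrite !ge0_integral_mscale//; last 2 first.
- exact: measurable_funeneg.
- exact: measurable_funepos.
move: ip iN; case: (integral _ _ _) => // b _; case: (integral _ _ _) => // c _.
by rewrite -!EFinM -!EFinB /= mulrBr.
Qed.

(** Any decomposition of a charge into two finite measures computes its
   integral and bounds its total variation.  Sums, multiples and point masses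
   come with such decompositions, whereas their Jordan parts depend on where
   masses cancel. *)
Section decomposition.
Variables (u : radon R) (m1 m2 : {measure set (torus R) -> \bar R}).
Hypotheses (m1T : (m1 setT < +oo)%E) (m2T : (m2 setT < +oo)%E).
Hypothesis uE : forall A, measurable A -> u A = (m1 A - m2 A)%E.

Lemma finite_measure_fin_num m A : (m setT < +oo)%E -> measurable A -> m A \is a fin_num.
Proof.
move=> mT mA; rewrite ge0_fin_numE//; apply: le_lt_trans mT.
by apply: le_measure; rewrite ?inE.
Qed.

Lemma cintegral_decomposition f : bounded_measurable f ->
  cintegral u f = \int[m1]_x f x - \int[m2]_x f x.
Proof.
move=> bf; apply/eqP; rewrite /cintegral subr_eq addrAC -subr_eq opprK; apply/eqP.
rewrite -!Rintegral_measure_add//; [|exact: neg_lty|exact: pos_lty].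
congr fine; apply: eq_measure_integral => A mA _.
rewrite [LHS]measure_addE [RHS]measure_addE.
have key (a b c d : \bar R) : a \is a fin_num -> b \is a fin_num ->
    c \is a fin_num -> d \is a fin_num -> (a - b = c - d -> a + d = c + b)%E.
  case: a b c d => [a||] [b||] [c||] [d||]// _ _ _ _ [e]; congr EFin.
  by move/eqP: e; rewrite subr_eq addrAC -subr_eq opprK => /eqP.
apply: key; rewrite ?fin_num_measure//; try exact: finite_measure_fin_num.
by rewrite -uE// -jordanE.
Qed.

Lemma tv_norm_decomposition : tv_norm u <= fine (m1 setT) + fine (m2 setT).
Proof.
have [[mP _] [mN _] _ _] := hahnP u.
have sub (a b : \bar R) : (0 <= b -> a - b <= a)%E.
  by move=> b0; rewrite geeDl// oppe_le0.
have le1 (m : {measure set (torus R) -> \bar R}) A : measurable A -> (m A <= m setT)%E.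
  by move=> mA; apply: le_measure; rewrite ?inE.
have posE : (pos u setT = u (hahn_pos u)).
  by rewrite /jordan_pos/= /measure_of_charge/= /crestr0 mem_set//= /crestr setTI.
have negE : (neg u setT = - u (hahn_neg u))%E.
  by rewrite jordan_negE cjordan_negE /crestr0 mem_set//= /crestr setTI.
rewrite tv_normE lerD//; apply: fine_le; rewrite ?fin_num_measure//;
  do ?exact: finite_measure_fin_num.
- rewrite posE uE//; apply: le_trans (le1 m1 _ mP).
  by apply: sub; exact: measure_ge0.
- rewrite negE uE// fin_num_oppeB ?finite_measure_fin_num// addeC.
  apply: le_trans (le1 m2 _ mN).
  by apply: sub; exact: measure_ge0.
Qed.
End decomposition.

End signed_measures.

Section signed_measure_operations.
Variable R : realType.
Implicit Types (u v : radon R) (f : torus R -> R) (m : {measure set (torus R) -> \bar R}).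

Local Notation pos u := (jordan_pos (hahnP u)).
Local Notation neg u := (jordan_neg (hahnP u)).

Lemma eq_radon_cintegral u v f : bounded_measurable f -> eq_radon u v ->
  cintegral u f = cintegral v f.
Proof.
move=> bf uv; apply: cintegral_decomposition => //; [exact: pos_lty|exact: neg_lty|].
by move=> A mA; rewrite uv// (jordanE v mA).
Qed.

Lemma measure_add_lty m1 m2 : (m1 setT < +oo -> m2 setT < +oo ->
  measure_add m1 m2 setT < +oo)%E.
Proof. by move=> h1 h2; rewrite measure_addE lte_add_pinfty. Qed.

Lemma mscale_lty m (a : {nonneg R}) : (m setT < +oo -> mscale a m setT < +oo)%E.
Proof. by move=> h; rewrite /mscale/= lte_mul_pinfty. Qed.

Lemma caddE u v A : measurable A -> cadd u v A =
  (measure_add (pos u) (pos v) A - measure_add (neg u) (neg v) A)%E.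
Proof.
move=> mA; rewrite [measure_add (pos _) _ _]measure_addE [measure_add (neg _) _ _]measure_addE.
rewrite /cadd/= (jordanE u mA) (jordanE v mA) fin_num_oppeD ?fin_num_measure//.
by rewrite addeACA.
Qed.

Lemma cintegral_cadd u v f : bounded_measurable f ->
  cintegral (cadd u v) f = cintegral u f + cintegral v f.
Proof.
move=> bf; rewrite (cintegral_decomposition _ _ (caddE u v))//.
- rewrite !Rintegral_measure_add//; try exact: pos_lty; try exact: neg_lty.
  by rewrite /cintegral; ring.
- by apply: measure_add_lty; exact: pos_lty.
- by apply: measure_add_lty; exact: neg_lty.
Qed.

Lemma tv_norm_cadd u v : tv_norm (cadd u v) <= tv_norm u + tv_norm v.
Proof.
apply: le_trans (tv_norm_decomposition _ _ (caddE u v)) _.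
- by apply: measure_add_lty; exact: pos_lty.
- by apply: measure_add_lty; exact: neg_lty.
have addE m1 m2 : (m1 setT < +oo)%E -> (m2 setT < +oo)%E ->
    fine (measure_add m1 m2 setT) = fine (m1 setT) + fine (m2 setT).
  by move=> ? ?; rewrite measure_addE fineD// ge0_fin_numE.
rewrite !tv_normE addrACA lerD//.
  by rewrite addE//; exact: pos_lty.
by rewrite addE//; exact: neg_lty.
Qed.

Lemma cscaleE (a : R) u A : measurable A -> cscale a u A =
  if 0 <= a then (mscale (`|a|%:nng)%R (pos u) A - mscale (`|a|%:nng)%R (neg u) A)%E
  else (mscale (`|a|%:nng)%R (neg u) A - mscale (`|a|%:nng)%R (pos u) A)%E.
Proof.
move=> mA; rewrite /cscale/= /mscale/= (jordanE u mA).
have : pos u A \is a fin_num by rewrite fin_num_measure.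
have : neg u A \is a fin_num by rewrite fin_num_measure.
case: (pos u A) (neg u A) => [b||] [c||]// _ _.
by have [a0|a0] := leP 0 a; rewrite ?(ger0_norm a0) ?(ltr0_norm a0) -?EFinM -?EFinB ?EFinN;
  congr EFin; ring.
Qed.

Lemma cintegral_cscale (a : R) u f : bounded_measurable f ->
  cintegral (cscale a u) f = a * cintegral u f.
Proof.
move=> bf; have := @cscaleE a u.
have [a0 E|a0 E] := leP 0 a.
- rewrite (cintegral_decomposition _ _ E)//; try (apply: mscale_lty; exact: pos_lty);
    try (apply: mscale_lty; exact: neg_lty).
  rewrite !Rintegral_mscale//; try exact: pos_lty; try exact: neg_lty.
  by rewrite /= ger0_norm// /cintegral mulrBr.
- rewrite (cintegral_decomposition _ _ E)//; try (apply: mscale_lty; exact: pos_lty);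
    try (apply: mscale_lty; exact: neg_lty).
  rewrite !Rintegral_mscale//; try exact: pos_lty; try exact: neg_lty.
  by rewrite /= ltr0_norm// /cintegral; ring.
Qed.

Lemma fine_mscale m (a : {nonneg R}) : (m setT < +oo)%E ->
  fine (mscale a m setT) = a%:num * fine (m setT).
Proof. by move=> mT; rewrite /mscale/= fineM// ge0_fin_numE. Qed.

Lemma tv_norm_cscale (a : R) u : tv_norm (cscale a u) <= `|a| * tv_norm u.
Proof.
have := @cscaleE a u; have [a0 E|a0 E] := leP 0 a.
- apply: le_trans (tv_norm_decomposition _ _ E) _;
    try (apply: mscale_lty; exact: pos_lty); try (apply: mscale_lty; exact: neg_lty).
  rewrite !fine_mscale/= ?tv_normE ?mulrDr//; first [exact: pos_lty|exact: neg_lty].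
- apply: le_trans (tv_norm_decomposition _ _ E) _;
    try (apply: mscale_lty; exact: pos_lty); try (apply: mscale_lty; exact: neg_lty).
  rewrite !fine_mscale/= ?tv_normE ?mulrDr; last 2 first.
    exact: pos_lty.
    exact: neg_lty.
  by rewrite addrC.
Qed.

Lemma mzero_lty : (mzero [set: torus R] < (+oo : \bar R))%E.
Proof. by rewrite /mzero ltry. Qed.

Lemma czeroE A : measurable A -> (czero : radon R) A = (mzero A - mzero A)%E.
Proof. by move=> mA; rewrite /czero/= /mzero sube0. Qed.

Lemma cintegral_czero f : bounded_measurable f -> cintegral czero f = 0.
Proof.
move=> bf.
rewrite (cintegral_decomposition mzero_lty mzero_lty czeroE)//.
exact: subrr.
Qed.

Lemma tv_norm_czero : tv_norm (czero : radon R) = 0.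
Proof.
apply/eqP; rewrite eq_le; apply/andP; split.
  apply: le_trans (tv_norm_decomposition mzero_lty mzero_lty czeroE) _.
  by rewrite /mzero/= addr0.
by rewrite tv_normE addr_ge0// fine_ge0.
Qed.

Lemma dirac_chargeE (x : torus R) A : measurable A ->
  charge_of_finite_measure (\d_x : {measure set torus R -> \bar R}) A = (\d_x A - mzero A)%E.
Proof. by move=> mA; rewrite /charge_of_finite_measure /mzero sube0. Qed.

Lemma Rintegral_mzero f : \int[(mzero : {measure set (torus R) -> \bar R})]_x f x = 0.
Proof. by rewrite /Rintegral integral_measure_zero. Qed.

Lemma dirac_lty (x : torus R) : (\d_x [set: torus R] < (+oo : \bar R))%E.
Proof. by rewrite diracT ltry. Qed.

Lemma cintegral_sdirac s (x : torus R) f : bounded_measurable f ->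
  cintegral (sdirac s x) f = s * f x.
Proof.
move=> bf; rewrite /sdirac cintegral_cscale//; congr (_ * _).
rewrite (cintegral_decomposition (dirac_lty x) mzero_lty (@dirac_chargeE x))//.
rewrite Rintegral_mzero subr0 /Rintegral integral_dirac//; last first.
  by apply/measurable_EFinP; case: bf.
by rewrite diracT mul1e.
Qed.

Lemma tv_norm_sdirac s (x : torus R) : tv_norm (sdirac s x) <= `|s|.
Proof.
rewrite /sdirac; apply: le_trans (tv_norm_cscale _ _) _.
rewrite -[leRHS]mulr1 ler_wpM2l//.
apply: le_trans (tv_norm_decomposition (dirac_lty x) mzero_lty (@dirac_chargeE x)) _.
have -> : 1 = fine (\d_x [set: torus R] : \bar R) + fine (mzero [set: torus R] : \bar R).
  by rewrite diracT /mzero/= addr0.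
exact: lexx.
Qed.

Lemma cintegral_comb n (c s : 'I_n -> R) (x : 'I_n -> torus R) f : bounded_measurable f ->
  cintegral (dirac_comb c s x) f = \sum_(i < n) c i * s i * f (x i).
Proof.
move=> bf; rewrite /dirac_comb; elim/big_rec2: _ => [|i y u _ <-].
  exact: cintegral_czero.
by rewrite cintegral_cadd// cintegral_cscale// cintegral_sdirac// mulrA.
Qed.

Lemma tv_norm_comb n (c s : 'I_n -> R) (x : 'I_n -> torus R) :
  tv_norm (dirac_comb c s x) <= \sum_(i < n) `|c i * s i|.
Proof.
rewrite /dirac_comb; elim/big_rec2: _ => [|i y u _ uy]; first by rewrite tv_norm_czero.
apply: le_trans (tv_norm_cadd _ _) _; rewrite lerD//.
apply: le_trans (tv_norm_cscale _ _) _; rewrite normrM ler_wpM2l//.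
exact: tv_norm_sdirac.
Qed.

Lemma cintegral_cB u v f : bounded_measurable f ->
  cintegral (cadd u (copp v)) f = cintegral u f - cintegral v f.
Proof.
move=> bf; rewrite cintegral_cadd//; congr (_ + _).
rewrite -mulN1r -cintegral_cscale//; apply: eq_radon_cintegral => // A mA.
exact: (esym (congr1 (fun g => g A) (cscaleN1 v))).
Qed.

Lemma Rintegral_bound m f (B : R) : (m setT < +oo)%E ->
  measurable_fun setT f -> (forall x, `|f x| <= B) ->
  `|\int[m]_x f x| <= B * fine (m setT).
Proof.
move=> mT mf fB; have bf : bounded_measurable f by split => //; exists B.
have i := bounded_measurable_integrable mT bf.
apply: le_trans (le_normr_Rintegral measurableT i) _.
rewrite -Rintegral_cst//; apply: le_Rintegral => //.
  by apply: bounded_measurable_integrable => //; split;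
    [exact: measurableT_comp|exists B => x; rewrite normr_id].
apply: (@bounded_measurable_integrable _ m (cst B)) => //.
by split => //; exists `|B|.
Qed.

Lemma cintegral_bound u f (B : R) : measurable_fun setT f -> (forall x, `|f x| <= B) ->
  `|cintegral u f| <= B * tv_norm u.
Proof.
move=> mf fB; rewrite /cintegral tv_normE mulrDr; apply: le_trans (ler_normB _ _) _.
by apply: lerD; apply: Rintegral_bound => //; [exact: pos_lty|exact: neg_lty].
Qed.

Lemma cintegralBr u f g : bounded_measurable f -> bounded_measurable g ->
  cintegral u (fun x => f x - g x) = cintegral u f - cintegral u g.
Proof.
move=> bf bg; rewrite /cintegral !RintegralB//;
  do ?[by apply: bounded_measurable_integrable => //; exact: pos_lty];
  do ?[by apply: bounded_measurable_integrable => //; exact: neg_lty].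
ring.
Qed.

End signed_measure_operations.

(** * The convolution operator and its pre-adjoint *)

Section convolution.
Variables (R : realType) (k : torus R -> R).
Implicit Types (u v : radon R) (p q : torus R -> R) (f : torus R -> R).

Local Notation pos u := (jordan_pos (hahnP u)).
Local Notation neg u := (jordan_neg (hahnP u)).

(** The image under [K] of the unit point mass at [x]. *)
Definition atom (x : torus R) : torus R -> R := fun s => k (x - s).

(** The derivative of [atom x] in the position [x]. *)
Definition datom (x : torus R) : torus R -> R := fun s => torus_derive1 k (x - s).

Lemma KpreE p x : Kpre k p x = L2inner (atom x) p.
Proof. by []. Qed.

Section kernel_bound.
Variable B : R.
Hypotheses (kC2 : C2_torus k) (kb : expansion_bound k B).

Let B0 : 0 < B. Proof. by case: kb. Qed.
Let kB x : `|k x| <= B. Proof. by case: kb. Qed.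
Let kLip x h : `|k (x + torus_pi h) - k x| <= B * `|h|. Proof. by case: kb. Qed.
Let kc : continuous k. Proof. by case: (C2_torus_continuous kC2). Qed.

Lemma continuous_translate x : continuous (fun y => k (y - x)).
Proof.
apply: (@lipschitz_torus_continuous _ _ B) => y t.
by rewrite addrAC.
Qed.

Lemma continuous_atom x : continuous (atom x).
Proof.
apply: (@lipschitz_torus_continuous _ _ B) => s t; rewrite /atom.
have -> : x - (s + torus_pi t) = x - s + torus_pi (- t).
  by rewrite -[- t]sub0r torus_piB torus_pi0 sub0r opprD addrA.
by rewrite -[`|t|]normrN.
Qed.

Lemma L2_atom x : L2 (atom x).
Proof. exact/continuous_L2/continuous_atom. Qed.

Lemma L2_atomB x t : L2norm (atom (x + torus_pi t) - atom x) <= B * `|t|.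
Proof.
apply: (bounded_L2 _ _).2.
  apply: L2_measurable; apply: L2B; exact: L2_atom.
by move=> s; rewrite !fctE /atom -addrAC.
Qed.

Lemma continuous_datom x : continuous (datom x).
Proof.
have [_ k1c _] := C2_torus_continuous kC2.
apply: torus_continuous.
rewrite (_ : periodic_lift (datom x) =
    periodic_lift (torus_derive1 k) \o (fun s => repr x - s)).
  move=> s; apply: continuous_comp; last exact: continuous_lift.
  by apply: continuousB => //; exact: cst_continuous.
by apply/funext => s; rewrite /periodic_lift/= torus_piB torus_pi_repr.
Qed.

Lemma L2_datom x : L2 (datom x).
Proof. exact/continuous_L2/continuous_datom. Qed.

Lemma L2_atom_taylor x t :
  L2norm (atom (x + torus_pi t) - atom x - t *: datom x) <= B * t ^+ 2.
Proof.
have [_ _ _ _ kT] := kb.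
apply: (bounded_L2 _ _).2.
  apply: L2_measurable; apply: L2B; [apply: L2B; exact: L2_atom|].
  by apply: L2Z; exact: L2_datom.
by move=> s; rewrite !fctE /atom /datom (addrAC x); exact: kT.
Qed.

Lemma L2norm_atom x : L2norm (atom x) <= B.
Proof. by apply: (bounded_L2 (L2_measurable (L2_atom x)) _).2 => s; exact: kB. Qed.

(** Taylor expansions are taken under the integral sign, at the level of the
   kernel; certificates are thus expanded with an error proportional to the
   norm of the dual variable, and never differentiated. *)
Lemma Kpre_taylor p x t : L2 p ->
  `|Kpre k p (x + torus_pi t) - Kpre k p x - t * L2inner (datom x) p|
  <= B * L2norm p * t ^+ 2.
Proof.
move=> L2p; have La := L2_atom; have Ld := L2_datom x.
have LB : L2 (atom (x + torus_pi t) - atom x) by exact: L2B.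
have LZ : L2 (t *: datom x) by exact: L2Z.
rewrite !KpreE -L2innerBl// -L2innerZl// -L2innerBl//.
apply: le_trans (cauchy_schwarz _ L2p) _; first exact: L2B.
by rewrite mulrAC ler_wpM2r ?L2norm_ge0 ?L2_atom_taylor.
Qed.

Lemma Kpre_bound p x : L2 p -> `|Kpre k p x| <= B * L2norm p.
Proof.
move=> L2p; rewrite KpreE.
apply: le_trans (cauchy_schwarz (L2_atom x) L2p) _; rewrite ler_wpM2r ?L2norm_ge0//.
by apply: (bounded_L2 (L2_measurable (L2_atom x)) _).2 => s; exact: kB.
Qed.

Lemma Kpre_continuous p : L2 p -> continuous (Kpre k p).
Proof.
move=> L2p; apply: (@lipschitz_torus_continuous _ _ (B * L2norm p)) => x t.
rewrite !KpreE -L2innerBl//; try exact: L2_atom.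
apply: le_trans (cauchy_schwarz _ L2p) _; first by apply: L2B; exact: L2_atom.
by rewrite mulrAC ler_wpM2r ?L2norm_ge0 ?L2_atomB.
Qed.

Lemma KpreB p q x : L2 p -> L2 q -> Kpre k (p - q) x = Kpre k p x - Kpre k q x.
Proof. by move=> L2p L2q; rewrite !KpreE L2innerBr//; exact: L2_atom. Qed.

Lemma KpreZ a p x : L2 p -> Kpre k (a *: p) x = a * Kpre k p x.
Proof. by move=> L2p; rewrite !KpreE L2innerZr//; exact: L2_atom. Qed.

Lemma K_continuous u : continuous (K k u).
Proof.
apply: (@lipschitz_torus_continuous _ _ (B * tv_norm u)) => s t; rewrite /K.
rewrite -cintegralBr; try exact/continuous_bounded_measurable/continuous_translate.
rewrite mulrAC; apply: cintegral_bound => [|x].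
  by apply: measurable_funB; apply: continuous_torus_measurable; exact: continuous_translate.
have -> : x - (s + torus_pi t) = x - s + torus_pi (- t).
  by rewrite -[- t]sub0r torus_piB torus_pi0 sub0r opprD addrA.
by rewrite -[`|t|]normrN.
Qed.

Lemma L2_K u : L2 (K k u).
Proof. exact/continuous_L2/K_continuous. Qed.

Lemma K_comb n (c s : 'I_n -> R) (x : 'I_n -> torus R) :
  K k (dirac_comb c s x) = \sum_(i < n) (c i * s i) *: atom (x i).
Proof.
apply/funext => y; rewrite /K cintegral_comb; first by rewrite fct_sumE.
exact/continuous_bounded_measurable/continuous_translate.
Qed.

(** Integrability on the product comes from domination by [B * |p|]. *)
Lemma fubini_kernel (m : {finite_measure set (torus R) -> \bar R}) p : L2 p ->
  \int[haar R]_s ((\int[m]_x k (x - s)) * p s) = \int[m]_x Kpre k p x.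
Proof.
move=> L2p; have mp := L2_measurable L2p.
have mT : (m setT < +oo)%E by rewrite ltey_eq fin_num_measure.
pose F (z : torus R * torus R) := (k (z.1 - z.2) * p z.2)%:E.
have mF : measurable_fun setT F.
  apply/measurable_EFinP; apply: measurable_funM.
    exact: measurable_difference.
  by apply: (measurableT_comp mp); exact: measurable_snd.
have ip : (haar R).-integrable setT (EFin \o p).
  apply/Lfun1_integrable; apply: (Lfun_subset12 _ L2p).
  by rewrite ge0_fin_numE//; exact: haar_lty.
pose G (z : torus R * torus R) := (B * p z.2)%:E.
have mG : measurable_fun setT G.
  apply/measurable_EFinP; apply: measurable_funM; first exact: measurable_cst.
  by apply: (measurableT_comp mp); exact: measurable_snd.
have iG : (m \x haar R)%E.-integrable setT G.
  apply/integrable12ltyP => //=.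
  have iBp : (haar R).-integrable setT (fun y => (B * p y)%:E).
    rewrite (_ : (fun y => _) = (fun y => B%:E * (EFin \o p) y)%E).
      exact: integrableZl.
    by apply/funext => y; rewrite EFinM.
  rewrite /G/= integral_cst//; case/integrableP : iBp => _ iBp.
  by rewrite lte_mul_pinfty// ?integral_ge0// ge0_fin_numE ?integral_ge0.
have iF : (m \x haar R)%E.-integrable setT F.
  apply: (le_integrable measurableT mF _ iG) => z _ /=.
  rewrite lee_fin !normrM ler_wpM2r//.
  by rewrite (le_trans (kB _))// ger0_norm// ltW.
have := Fubini iF; rewrite /F /= => FF.
rewrite /Rintegral; congr fine; rewrite -[RHS]/(\int[m]_x (EFin \o Kpre k p) x)%E.
transitivity (\int[haar R]_y \int[m]_x (k (x - y) * p y)%:E)%E.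
  apply: eq_integral => y _ /=.
  have iy : m.-integrable setT (fun x => (k (x - y))%:E).
    exact/bounded_measurable_integrable/continuous_bounded_measurable/continuous_translate.
  under [RHS]eq_integral do rewrite EFinM.
  by rewrite integralZr// EFinM fineK//; exact: integrable_fin_num.
rewrite -FF; apply: eq_integral => x _ /=.
rewrite /Kpre /Rintegral fineK//.
have := L2_mul_integrable (L2_atom x) L2p; exact: integrable_fin_num.
Qed.

Lemma K_adjoint u p : L2 p -> L2inner (K k u) p = cintegral u (Kpre k p).
Proof.
move=> L2p; rewrite /cintegral -!fubini_kernel// /L2inner.
have mE (m : {finite_measure set (torus R) -> \bar R}) :
    continuous (fun s => \int[m]_x k (x - s)).
  have mT : (m setT < +oo)%E by rewrite ltey_eq fin_num_measure.
  have cm (x : torus R) := continuous_torus_measurable (@continuous_translate x).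
  have ci (x : torus R) := continuous_bounded_measurable (@continuous_translate x).
  apply: (@lipschitz_torus_continuous _ _ (B * fine (m setT))) => s t.
  rewrite -RintegralB//; try exact: bounded_measurable_integrable.
  rewrite mulrAC; apply: Rintegral_bound => // [|x].
    by apply: measurable_funB; exact: cm.
  have -> : x - (s + torus_pi t) = x - s + torus_pi (- t).
    by rewrite -[- t]sub0r torus_piB torus_pi0 sub0r opprD addrA.
  by rewrite -[`|t|]normrN.
rewrite -RintegralB//; last 2 first.
- exact: L2_mul_integrable (continuous_L2 (mE _)) L2p.
- exact: L2_mul_integrable (continuous_L2 (mE _)) L2p.
by apply: eq_Rintegral => s _; rewrite -mulrBl.
Qed.

End kernel_bound.
End convolution.

(** * Duality *)

Section extremal_measures.
Variable R : realType.
Implicit Types (u v : radon R) (f : torus R -> R) (m : {measure set (torus R) -> \bar R}).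

Local Notation pos u := (jordan_pos (hahnP u)).
Local Notation neg u := (jordan_neg (hahnP u)).

Lemma measure_on_points m n (x : 'I_n -> torus R) :
  injective x -> m (~` \big[setU/set0]_(i < n) [set x i]) = 0%E ->
  forall A, measurable A -> m A = (\sum_(i < n) m [set x i] * \d_(x i) A)%E.
Proof.
move=> xinj m0 A mA; set S := \big[setU/set0]_(i < n) [set x i] in m0.
have mS : measurable S by apply: bigsetU_measurable => i _; exact: measurable_torus1.
have -> : m A = m (A `&` S).
  rewrite -[in LHS](setIT A) -(setUv S) setIUr measureU//; last 3 first.
  - exact: measurableI.
  - by apply: measurableI => //; exact: measurableC.
  - by rewrite setIACA setICr setI0.
  rewrite [X in (_ + X)%E](_ : _ = 0%E) ?adde0//.
  apply: (@subset_measure0 _ _ _ m _ (~` S)) => //; last exact: measurableC.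
  by apply: measurableI => //; exact: measurableC.
have -> : A `&` S = \big[setU/set0]_(i < n) (A `&` [set x i]).
  by rewrite /S; apply: (big_morph (setI A)) => [a b|]; rewrite ?setIUr ?setI0.
have mAi i : measurable (A `&` [set x i]).
  by apply: measurableI => //; exact: measurable_torus1.
rewrite measure_bigsetU_ord//; last first.
  by apply/trivIsetP => i j _ _ ij; rewrite setIACA setIid (_ : _ `&` [set x j] = set0) ?setI0//;
    apply/seteqP; split => // y /= [-> /xinj e]; rewrite e eqxx in ij.
apply: eq_bigr => i _; rewrite diracE; have [xA|xA] := boolP (x i \in A).
  by rewrite mule1; congr (m _); rewrite setI1 xA.
by rewrite mule0 setI1 (negbTE xA) measure0.
Qed.

(** Equality in [cintegral v f <= tv_norm v] forces [v] to live where [f] is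
   extremal; finitely many such points leave only combs. *)
Lemma extremal_measure_comb v f n (x : 'I_n -> torus R) :
  continuous f -> (forall y, `|f y| <= 1) -> injective x ->
  (forall y, `|f y| = 1 -> exists i, y = x i) ->
  tv_norm v <= cintegral v f ->
  exists a : 'I_n -> R, eq_radon v (dirac_comb a (fun=> 1) x).
Proof.
move=> fc f1 xinj fx vf.
have bf := continuous_bounded_measurable fc.
have iP := bounded_measurable_integrable (pos_lty v) bf.
have iN := bounded_measurable_integrable (neg_lty v) bf.
have b1 m : (m setT < +oo)%E -> m.-integrable setT (EFin \o (fun=> 1 : R)).
  by move=> mT; apply: bounded_measurable_integrable => //; split => //; exists 1 => y; rewrite normr1.
have f1' y : -1 <= f y <= 1 by rewrite -ler_norml.
have gP : 0 <= \int[pos v]_y (1 - f y).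
  by apply: Rintegral_ge0 => y _; rewrite subr_ge0; case/andP: (f1' y).
have gN : 0 <= \int[neg v]_y (1 + f y).
  by apply: Rintegral_ge0 => y _; rewrite -lerBlDl sub0r; case/andP: (f1' y).
have sum0 : \int[pos v]_y (1 - f y) + \int[neg v]_y (1 + f y) <= 0.
  rewrite RintegralB ?RintegralD//; try exact: b1 (pos_lty v); try exact: b1 (neg_lty v).
  rewrite !Rintegral_cst// !mul1r; move: vf; rewrite tv_normE /cintegral => vf.
  by rewrite addrACA [X in _ + X]addrC -opprB subr_le0.
have /andP[/eqP P00 /eqP N00] : (\int[pos v]_y (1 - f y) == 0) && (\int[neg v]_y (1 + f y) == 0).
  by rewrite -paddr_eq0// eq_le sum0 addr_ge0.
have mf := bf.1.
set S := \big[setU/set0]_(i < n) [set x i].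
have mS : measurable S by apply: bigsetU_measurable => i _; exact: measurable_torus1.
have SP y : (exists i, y = x i) -> S y.
  by move=> [i ->]; rewrite /S -bigcup_seq; exists i => //=; rewrite mem_index_enum.
have null m (g : torus R -> R) : measurable_fun setT g -> m.-integrable setT (EFin \o g) ->
    (forall y, 0 <= g y) -> \int[m]_y g y = 0 ->
    (forall y, g y = 0 -> `|f y| = 1) -> m (~` S) = 0%E.
  move=> mg ig g0 int0 gf.
  have : (\int[m]_(y in setT) `|(g y)%:E| = 0)%E.
    under eq_integral => y _ do rewrite gee0_abs ?lee_fin//.
    by rewrite -[LHS]fineK ?[fine _]int0//; exact: integrable_fin_num ig.
  move/ae_eq_integral_abs => []//; first exact/measurable_EFinP.
  move=> A [mA A0 sub]; apply: (@subset_measure0 _ _ _ m _ A) => //; first exact: measurableC.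
  move=> y Sy; apply: sub => /= H; apply: Sy; apply/SP/fx/gf.
  by have [] := H I.
have P0 : pos v (~` S) = 0%E.
  apply: (null (pos v) (fun y => 1 - f y)).
  - exact: measurable_funB.
  - rewrite (_ : _ \o _ = (fun y => (1%:E - (f y)%:E)%E)) //.
    by apply: integrableB => //; exact: (b1 (pos v) (pos_lty v)).
  - by move=> y; rewrite subr_ge0; case/andP: (f1' y).
  - exact: P00.
  - by move=> y /subr0_eq <-; rewrite normr1.
have N0 : neg v (~` S) = 0%E.
  apply: (null (neg v) (fun y => 1 + f y)).
  - exact: measurable_funD.
  - rewrite (_ : _ \o _ = (fun y => (1%:E + (f y)%:E)%E)) //.
    by apply: integrableD => //; exact: (b1 (neg v) (neg_lty v)).
  - by move=> y; rewrite -lerBlDl sub0r; case/andP: (f1' y).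
  - exact: N00.
  - by move=> y /eqP; rewrite addrC addr_eq0 => /eqP ->; rewrite normrN1.
have fP i : pos v [set x i] \is a fin_num.
  by rewrite fin_num_measure//; exact: measurable_torus1.
have fN i : neg v [set x i] \is a fin_num.
  by rewrite fin_num_measure//; exact: measurable_torus1.
exists (fun i => fine (pos v [set x i]) - fine (neg v [set x i])) => A mA.
rewrite dirac_combE (jordanE v mA).
rewrite (measure_on_points xinj P0 mA) (measure_on_points xinj N0 mA).
rewrite (eq_bigr (fun i => ((fine (pos v [set x i]))%:E * \d_(x i) A)%E)); last first.
  by move=> i _; rewrite fineK.
rewrite [X in (_ - X)%E](eq_bigr (fun i => ((fine (neg v [set x i]))%:E * \d_(x i) A)%E)); last first.
  by move=> i _; rewrite fineK.
rewrite -sumeN; last by move=> i j _ _; rewrite diracE -EFinM fin_num_adde_defr.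
rewrite -big_split; apply: eq_bigr => i _ /=.
by rewrite diracE mulr1; congr EFin; exact: (esym (mulrBl _ _ _)).
Qed.

End extremal_measures.

Section dual_problem.
Variables (R : realType) (k : torus R -> R) (B : R).
Hypotheses (kC2 : C2_torus k) (kb : expansion_bound k B).
Implicit Types (v : radon R) (p q : torus R -> R).

Let B0 : 0 < B. Proof. by case: kb. Qed.

Lemma Kpre_bounded_measurable p : L2 p -> bounded_measurable (Kpre k p).
Proof. by move=> L2p; exact: continuous_bounded_measurable (Kpre_continuous kb L2p). Qed.

(** Testing the subgradient inequality on signed point masses turns
   feasibility into a pointwise bound. *)
Lemma dual_feasibleP p :
  dual_feasible k p <-> L2 p /\ forall x, `|Kpre k p x| <= 1.
Proof.
split=> [[L2p [ec sub]]|[L2p p1]].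
  split => // x; have bf := continuous_bounded_measurable ec.
  have H s : `|s| <= 1 -> s * Kpre k p x <= 1.
    move=> s1; have := sub (sdirac s x).
    rewrite cintegral_cB// cintegral_czero// subr0 tv_norm_czero add0r cintegral_sdirac//.
    by move=> /le_trans; apply; apply: le_trans (tv_norm_sdirac s x) s1.
  have := H 1; have := H (-1); rewrite normrN1 normr1 mul1r mulN1r => HN H1.
  by rewrite ler_norml H1// andbT lerNl HN.
have ec := Kpre_continuous kb L2p.
have bf := continuous_bounded_measurable ec.
split => //; split => // v.
rewrite cintegral_cB// cintegral_czero// subr0 tv_norm_czero add0r.
by have := cintegral_bound v bf.1 p1; rewrite mul1r; exact: le_trans (ler_norm _).
Qed.

Lemma dual_feasible_pairing v p : dual_feasible k p -> L2inner (K k v) p <= tv_norm v.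
Proof.
move=> /dual_feasibleP[L2p p1]; rewrite (K_adjoint kC2 kb)//.
rewrite (le_trans (ler_norm _))//.
have := cintegral_bound v (Kpre_bounded_measurable L2p).1 p1.
by rewrite mul1r.
Qed.

Lemma comb_pairing n (c s : 'I_n -> R) (x : 'I_n -> torus R) p : L2 p ->
  L2inner (K k (dirac_comb c s x)) p = \sum_(i < n) c i * s i * Kpre k p (x i).
Proof.
move=> L2p; rewrite (K_adjoint kC2 kb)// cintegral_comb//.
exact: Kpre_bounded_measurable.
Qed.

Section certificate.
Variables (n : nat) (c0 sigma : 'I_n -> R) (x0 : 'I_n -> torus R).
Let y0 := K k (dirac_comb c0 sigma x0).
Let p0 := xget (cst 0) (min_norm_dual_solution k y0).
Let eta0 := min_norm_certificate k y0.
Hypothesis eta0_sigma : forall i, sigma i * eta0 (x0 i) = 1.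

(** Among feasible functions the dual solutions are those whose certificate
   interpolates the signs, so minimality of the norm can be tested on the latter
   condition.  Were there no minimal-norm solution, the chosen representative
   would be zero, for which both claims are trivial. *)
Lemma min_norm_dualP :
  dual_feasible k p0 /\
  forall q, dual_feasible k q -> (forall i, sigma i * Kpre k q (x0 i) = 1) ->
    L2norm p0 <= L2norm q.
Proof.
have [[p minp]|nomin] := pselect (exists p, min_norm_dual_solution k y0 p).
  have : min_norm_dual_solution k y0 p0 by apply: xgetPex; exists p.
  move=> [[fp0 maxp0] minp0]; split => // q fq qs; apply: minp0; split => // q' fq'.
  suff -> : L2inner y0 q = L2inner y0 p0 by exact: maxp0.
  have [[L2q _] [L2p0 _]] := (fq, fp0).
  rewrite /y0 !comb_pairing//; apply: eq_bigr => i _.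
  by rewrite -!mulrA qs -[Kpre k p0]/(eta0) eta0_sigma.
have -> : p0 = cst 0.
  by apply: xgetPN => q minq; apply: nomin; exists q.
have L2c : L2 (cst 0 : torus R -> R) by exact: L20.
have N0 : L2norm (cst 0 : torus R -> R) = 0.
  by apply/eqP; rewrite -sqrf_eq0 L2norm_sqr// L2inner0l.
split=> [|q _ _]; last by rewrite N0 L2norm_ge0.
apply/dual_feasibleP; split => // x.
have := Kpre_bound kb x L2c; rewrite N0 mulr0 => /le_trans; apply.
exact: ler01.
Qed.

End certificate.
End dual_problem.

(** * Nondegenerate certificates *)

Lemma positive_lower_bound (R : realType) n (F : 'I_n -> R) : (forall i, 0 < F i) ->
  exists2 m : R, 0 < m & forall i, m <= F i.
Proof.
elim: n F => [|n IH] F F0; first by exists 1 => // -[].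
have [m m0 mF] := IH (F \o lift ord0) (fun i => F0 _).
exists (Num.min (F ord0) m); first by rewrite lt_min F0.
move=> i; case: (unliftP ord0 i) => [j ->|->]; rewrite ge_min ?lexx//.
by rewrite (mF j) orbT.
Qed.

Section nondegenerate.
Variables (R : realType) (f : torus R -> R).
Variables (n : nat) (sigma : 'I_n -> R) (x0 : 'I_n -> torus R).
Hypothesis fC2 : C2_torus f.
Hypothesis f1 : forall x, `|f x| <= 1.
Hypothesis sgn : forall i, is_sign (sigma i).
Hypothesis contact : forall s x, is_sign s ->
  s * f x = 1 <-> exists i, s = sigma i /\ x = x0 i.
Hypothesis curved : forall i, sigma i * torus_derive2 f (x0 i) < 0.

Lemma sign_sqr s : @is_sign R s -> s * s = 1.
Proof. by case=> ->; rewrite ?mulrNN mulr1. Qed.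

Lemma sign_norm s : @is_sign R s -> `|s| = 1.
Proof. by case=> ->; rewrite ?normrN normr1. Qed.

Lemma contact_value i : sigma i * f (x0 i) = 1.
Proof. by apply/contact => //; exists i. Qed.

Lemma norm1_contact x : `|f x| = 1 -> exists i, x = x0 i.
Proof.
move=> fx; have [s [ss sf]] : exists s, is_sign s /\ s * f x = 1.
  have [f0|f0] := leP 0 (f x).
    by exists 1; split; [left|rewrite mul1r -(ger0_norm f0)].
  by exists (-1); split; [right|rewrite mulN1r -(ltr0_norm f0)].
by have [i [_ ->]] := (contact x ss).1 sf; exists i.
Qed.

Lemma sign_mul_le1 i x : sigma i * f x <= 1.
Proof. by rewrite (le_trans (ler_norm _))// normrM sign_norm// mul1r. Qed.

Lemma contact_derive1 i : torus_derive1 f (x0 i) = 0.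
Proof.
have [C [_ _ _ _ fT]] := C2_torus_expansion fC2.
suff : - (sigma i * torus_derive1 f (x0 i)) = 0.
  by move/eqP; rewrite oppr_eq0; case: (sgn i) => ->; rewrite ?mul1r ?mulN1r ?oppr_eq0 => /eqP.
apply: (@first_order_eq0 _ _ C 1) => // h _.
have := fT (x0 i) h; have := sign_mul_le1 i (x0 i + torus_pi h); have := contact_value i.
rewrite ler_norml => e1 e2 /andP[e3 e4].
case: (sgn i) e1 e2 => ->; lra.
Qed.

(** The constants of [C2_torus_strict_concave] made uniform over the spikes;
   [kr.2] is moreover so small that the certificate keeps its sign. *)
Lemma certificate_curvature : exists kr : R * R,
  [/\ 0 < kr.1, 0 < kr.2,
     (forall i a b, `|a| <= kr.2 -> `|b| <= kr.2 ->
        sigma i * f (x0 i + torus_pi b) <= sigma i * f (x0 i + torus_pi a) +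
        (b - a) * (sigma i * torus_derive1 f (x0 i + torus_pi a)) - kr.1 * (b - a) ^+ 2) &
     forall i b, `|b| <= kr.2 -> 0 <= sigma i * f (x0 i + torus_pi b)].
Proof.
have /choice[F FP] := fun i => C2_torus_strict_concave fC2 (curved i).
have F1 i : 0 < (F i).1 by case: (FP i).
have F2 i : 0 < (F i).2 by case: (FP i).
have [ka ka0 kaF] := positive_lower_bound F1.
have [r r0 rF] := positive_lower_bound F2.
have [C [C0 _ _ fL _]] := C2_torus_expansion fC2.
exists (ka, Num.min r C^-1); split => //=.
- by rewrite lt_min r0 invr_gt0.
- move=> i a b; rewrite !le_min => /andP[ar _] /andP[br _].
  have [_ _ conc] := FP i.
  apply: le_trans (conc a b _ _) _; rewrite ?(le_trans _ (rF i))//.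
  by rewrite lerD2l lerN2 ler_wpM2r// ?sqr_ge0.
- move=> i b; rewrite le_min => /andP[_ bC].
  have := fL (x0 i) b; rewrite ler_norml => /andP[e1 e2].
  have Cb : C * `|b| <= 1 by rewrite mulrC -ler_pdivlMr// div1r.
  have := contact_value i; case: (sgn i) => ->; lra.
Qed.

(** Away from open arcs around the spikes the certificate ranges over a
   compact set on which it never has modulus 1. *)
Lemma certificate_gap (r : R) : 0 < r -> exists2 delta : R, 0 < delta &
  forall x, (forall i h, `|h| < r -> x <> x0 i + torus_pi h) -> `|f x| <= 1 - delta.
Proof.
move=> r0; pose arc i := [set t | exists2 s, `|s| < r & torus_pi t = x0 i + torus_pi s].
pose E := `[0, 1]%classic `&` ~` (\bigcup_i arc i).
have cE : compact E.
  apply: compact_closedI; first exact: segment_compact.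
  by apply: open_closedC; apply: bigcup_open => i _; exact: open_arc.
have inE01 t : 0 <= t <= 1 -> (forall i h, `|h| < r -> torus_pi t <> x0 i + torus_pi h) -> E t.
  move=> t01 th; split => /=; first by rewrite in_itv.
  by move=> [i _ [s sr ts]]; exact: th ts.
have [[t0 Et0]|E0] := pselect (exists t, E t); last first.
  exists 1 => //; apply: torus_frac_ind => t t01 th.
  by exfalso; apply: E0; exists t; exact: inE01.
have [fc _ _] := C2_torus_continuous fC2.
have [|c Ec cmax] := @compact_EVT_max _ R (fun t => `|periodic_lift f t|) E (ex_intro _ t0 Et0) cE.
  apply: continuous_subspaceT => t.
  apply: (@continuous_comp _ _ _ (periodic_lift f) (fun s => `|s|)).
    exact: continuous_lift.
  exact: norm_continuous.
exists (1 - `|periodic_lift f c|); last first.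
  apply: torus_frac_ind => t t01 th; rewrite subKr; apply: cmax.
  by rewrite inE; exact: inE01.
rewrite subr_gt0 lt_neqAle f1 andbT; apply/eqP => /norm1_contact[i ci].
move: Ec; rewrite inE => -[_]; apply; exists i => //=.
by exists 0; rewrite ?normr0// torus_pi0 addr0.
Qed.

End nondegenerate.

(** * The minimal-norm certificate *)

Section min_norm_certificate.
Variables (R : realType) (k : torus R -> R) (B : R).
Hypotheses (kC2 : C2_torus k) (kb : expansion_bound k B).
Variables (n : nat) (c0 sigma : 'I_n -> R) (x0 : 'I_n -> torus R).
Let y0 := K k (dirac_comb c0 sigma x0).
Let p0 := xget (cst 0) (min_norm_dual_solution k y0).
Let eta0 := min_norm_certificate k y0.
Hypothesis c0_gt0 : forall i, 0 < c0 i.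
Hypothesis sgn : forall i, is_sign (sigma i).
Hypothesis contact : forall s x, is_sign s ->
  s * eta0 x = 1 <-> exists i, s = sigma i /\ x = x0 i.
Hypothesis etaC2 : C2_torus eta0.
Hypothesis curved : forall i, sigma i * torus_derive2 eta0 (x0 i) < 0.

Let B0 : 0 < B. Proof. by case: kb. Qed.

Let eta0_sigma i : sigma i * eta0 (x0 i) = 1.
Proof. by apply/contact => //; exists i. Qed.

Lemma min_norm_feasible : dual_feasible k p0.
Proof. exact: (min_norm_dualP kC2 kb eta0_sigma).1. Qed.

Lemma min_norm_L2 : L2 p0.
Proof. by case/(dual_feasibleP kb) : min_norm_feasible. Qed.

Lemma min_norm_certificate_le1 x : `|eta0 x| <= 1.
Proof. by case/(dual_feasibleP kb) : min_norm_feasible => _; exact. Qed.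

(** Both sides are the first-order coefficient of [eta0] at [x]. *)
Lemma min_norm_derive1 x : L2inner (datom k x) p0 = torus_derive1 eta0 x.
Proof.
have [C [_ _ _ _ fT]] := C2_torus_expansion etaC2.
apply/eqP; rewrite -subr_eq0; apply/eqP; apply: (@first_order_eq0 _ _ (C + B * L2norm p0) 1) => // h _.
have := fT x h; have := Kpre_taylor kC2 kb x h min_norm_L2.
rewrite -/(min_norm_certificate k y0) -/eta0 !ler_norml => /andP[e1 e2] /andP[e3 e4].
lra.
Qed.

(** Moving from [p0] against a direction that is orthogonal to the atoms and
   to their derivatives at the spikes neither changes the contacts nor leaves
   the feasible set: the perturbation of the certificate vanishes to second
   order where the certificate is strictly curved.  Minimality of the norm
   thus excludes such directions. *)
Lemma feasible_perturbation d : L2 d ->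
  (forall i, L2inner (atom k (x0 i)) d = 0) ->
  (forall i, L2inner (datom k (x0 i)) d = 0) ->
  exists2 T : R, 0 < T & forall t, 0 <= t <= T -> dual_feasible k (p0 - t *: d).
Proof.
move=> L2d ad dd; have L2p := min_norm_L2.
have [[ka r] [/= ka0 r0 conc low]] := certificate_curvature etaC2 sgn contact curved.
have [de de0 gap] := certificate_gap etaC2 min_norm_certificate_le1 contact r0.
pose M := B * L2norm d + 1.
have M0 : 0 < M by rewrite ltr_wpDl// mulr_ge0 ?L2norm_ge0 ?ltW.
exists (Num.min (Num.min ka de) 1 / M).
  by rewrite divr_gt0// !lt_min ka0 de0 ltr01.
move=> t /andP[t0 tT]; apply/(dual_feasibleP kb).
have L2t : L2 (t *: d) by exact: L2Z.
split=> [|x]; first exact: L2B.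
have -> : Kpre k (p0 - t *: d) x = eta0 x - t * Kpre k d x by rewrite (KpreB kb)// (KpreZ kb).
have : t * M <= Num.min (Num.min ka de) 1 by rewrite -ler_pdivlMr.
rewrite !le_min => /andP[/andP[tka tde] t1].
have BM : B * L2norm d <= M by rewrite lerDl.
have Kd : t * `|Kpre k d x| <= t * M.
  by rewrite ler_wpM2l// (le_trans (Kpre_bound kb x L2d)).
have [[i [h [hr xE]]]|far] := pselect (exists i h, `|h| < r /\ x = x0 i + torus_pi h); last first.
  apply: le_trans (ler_normB _ _) _; rewrite normrM (ger0_norm t0).
  have : `|eta0 x| <= 1 - de by apply: gap => i h hr xE; apply: far; exists i, h.
  lra.
(* on an arc the perturbation is quadratic and is absorbed by the curvature *)
have hr' : `|h| <= r by exact: ltW.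
have Kdh : t * `|Kpre k d x| <= ka * h ^+ 2.
  have := Kpre_taylor kC2 kb (x0 i) h L2d.
  rewrite dd mulr0 subr0 (KpreE k d (x0 i)) ad subr0 -xE => Kh.
  apply: le_trans (_ : t * (M * h ^+ 2) <= _); last first.
    by rewrite mulrA ler_wpM2r// sqr_ge0.
  by rewrite ler_wpM2l// (le_trans Kh)// ler_wpM2r// sqr_ge0.
have := conc i 0 h; rewrite normr0 => /(_ (ltW r0) hr').
rewrite torus_pi0 addr0 eta0_sigma (contact_derive1 etaC2 min_norm_certificate_le1 sgn contact).
rewrite !mulr0 addr0 subr0 -xE => c1.
have := low i h hr'; rewrite -xE => c2.
have : `|t * Kpre k d x| <= ka * h ^+ 2 by rewrite normrM (ger0_norm t0).
have : `|t * Kpre k d x| <= 1 by rewrite normrM (ger0_norm t0); lra.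
rewrite !ler_norml => /andP[a1 a2] /andP[a3 a4].
by apply/andP; case: (sgn i) c1 c2 => ->; split; lra.
Qed.

(** The component of [p0] orthogonal to all atoms and their derivatives is a
   direction along which [p0] could be shortened, hence has norm zero. *)
Lemma min_norm_span : exists A D : 'I_n -> R,
  L2norm (p0 - \sum_(i < n) (A i *: atom k (x0 i) + D i *: datom k (x0 i))) = 0.
Proof.
pose g (j : 'I_(n + n)) := match fintype.split j with
  | inl i => atom k (x0 i) | inr i => datom k (x0 i) end.
have gl i : g (lshift n i) = atom k (x0 i) by rewrite /g (unsplitK (inl i)).
have gr i : g (rshift n i) = datom k (x0 i) by rewrite /g (unsplitK (inr i)).
have L2g j : L2 (g j).
  by rewrite /g; case: (fintype.split j) => i; [exact: (L2_atom kb)|exact: (L2_datom kC2)].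
have L2p := min_norm_L2.
have [a ga] := L2_projection L2g L2p.
set q := \sum_(i < n + n) a i *: g i in ga.
have L2q : L2 q by apply: L2_sum => j; exact: L2Z.
set d := p0 - q in ga.
have L2d : L2 d by exact: L2B.
exists (fun i => a (lshift n i)), (fun i => a (rshift n i)).
have -> : \sum_(i < n) (a (lshift n i) *: atom k (x0 i) + a (rshift n i) *: datom k (x0 i)) = q.
  rewrite /q big_split_ord/= big_split/=; congr (_ + _); apply: eq_bigr => i _.
    by rewrite gl.
  by rewrite gr.
rewrite -/d.
have p0d : L2inner p0 d = L2inner d d.
  rewrite {1}(_ : p0 = d + q); last by rewrite /d subrK.
  rewrite L2innerDl// [X in _ + X](_ : _ = 0) ?addr0//.
  rewrite /q L2inner_suml//; last by move=> j; exact: L2Z.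
  by rewrite big1// => j _; rewrite L2innerZl// L2innerC ga mulr0.
have [||T T0 feas] := feasible_perturbation L2d.
- by move=> i; rewrite -gl L2innerC ga.
- by move=> i; rewrite -gr L2innerC ga.
pose t := Num.min T 1.
have t0 : 0 < t by rewrite lt_min T0 ltr01.
have t1 : t <= 1 by rewrite ge_min lexx orbT.
have tT : 0 <= t <= T by rewrite ltW//= ge_min lexx.
have L2t : L2 (t *: d) by exact: L2Z.
have := (min_norm_dualP kC2 kb eta0_sigma).2 _ (feas t tT).
have contacts i : sigma i * Kpre k (p0 - t *: d) (x0 i) = 1.
  rewrite (KpreB kb)// (KpreZ kb)// mulrBr -/(eta0 _) eta0_sigma.
  by rewrite (KpreE k d) -gl L2innerC ga !mulr0 subr0.
move=> /(_ contacts).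
rewrite -(@ler_pXn2r _ 2)// ?nnegrE ?L2norm_ge0// !L2norm_sqr//; last exact: L2B.
rewrite L2innerBl// ?L2innerBr//; last exact: L2B.
rewrite !L2innerZl ?L2innerZr// (L2innerC d p0) p0d.
have := L2inner_ge0 d; set N := L2inner d d => N0 H.
apply/eqP; rewrite -sqrf_eq0 L2norm_sqr// -/N eq_le N0 andbT.
have H2 : t * N * (2 - t) <= 0 by move: H; lra.
move: H2; rewrite pmulr_lle0; last by lra.
by rewrite pmulr_rle0.
Qed.

(** A competitor in the noisy problem: shifting amplitudes and positions by
   the coefficients of [p0] in the atoms and their derivatives changes the
   observation by [- lambda p0] up to second order, at a second-order loss in
   the pairing with the certificate. *)
Lemma first_order_competitor : exists2 C : R, 0 < C &
  forall lambda, 0 < lambda <= 1 -> exists c t : 'I_n -> R,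
  [/\ forall i, `|c i - c0 i| <= C * lambda, forall i, `|t i| <= C * lambda,
      L2norm (y0 - K k (dirac_comb c sigma (fun i => x0 i + torus_pi (t i)))
              - lambda *: p0) <= C * lambda ^+ 2 &
      \sum_(i < n) c i * (1 - sigma i * eta0 (x0 i + torus_pi (t i)))
        <= C * lambda ^+ 2].
Proof.
have [A [D span]] := min_norm_span; have L2p := min_norm_L2.
pose tau i := `|D i| / c0 i.
have tau0 i : 0 <= tau i by rewrite divr_ge0// ltW.
pose C1 i := c0 i * (B * tau i ^+ 2) + `|A i| * (B * tau i).
pose C2 i := (c0 i + `|A i|) * (B * L2norm p0 * tau i ^+ 2).
pose C3 i := `|A i| + tau i.
have C10 i : 0 <= C1 i.
  have c0i := ltW (c0_gt0 i); have B0' := ltW B0.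
  by apply: addr_ge0; do 2!apply: mulr_ge0 => //; exact: exprn_ge0.
have C20 i : 0 <= C2 i.
  have c0i := ltW (c0_gt0 i); have B0' := ltW B0.
  apply: mulr_ge0; first exact: addr_ge0.
  by apply: mulr_ge0; [apply: mulr_ge0 => //; exact: L2norm_ge0|exact: exprn_ge0].
have C30 i : 0 <= C3 i by rewrite addr_ge0.
have S1 : 0 <= \sum_(i < n) C1 i by apply: sumr_ge0 => i _; exact: C10.
have S2 : 0 <= \sum_(i < n) C2 i by apply: sumr_ge0 => i _; exact: C20.
have S3 : 0 <= \sum_(i < n) C3 i by apply: sumr_ge0 => i _; exact: C30.
set C := 1 + \sum_(i < n) C1 i + \sum_(i < n) C2 i + \sum_(i < n) C3 i.
exists C; first by rewrite /C; move: S1 S2 S3 => /=; lra.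
move=> l /andP[l0 l1]; have l0' := ltW l0; have B0' := ltW B0.
pose c i := c0 i - l * (sigma i * A i).
pose t i := - (l * (sigma i * D i) / c0 i).
exists c, t.
have tE i : `|t i| = l * tau i.
  rewrite /t normrN !normrM (sign_norm (sgn i)) mul1r normfV (gtr0_norm l0) (gtr0_norm (c0_gt0 i)).
  by rewrite mulrA.
have C3C i : C3 i <= C.
  have : C3 i <= \sum_(i < n) C3 i by rewrite (bigD1 i)//= lerDl sumr_ge0.
  by rewrite /C; move: S1 S2 => /=; lra.
have La := L2_atom kb; have Ld := L2_datom kC2.
split.
- move=> i; rewrite /c addrAC subrr sub0r normrN !normrM (sign_norm (sgn i)) mul1r (gtr0_norm l0).
  rewrite mulrC ler_wpM2r// (le_trans _ (C3C i))//.
  by rewrite lerDl.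
- move=> i; rewrite tE mulrC ler_wpM2r// (le_trans _ (C3C i))//.
  by rewrite lerDr.
- rewrite /y0 !(K_comb kb).
  pose e i := (l * A i) *: (atom k (x0 i + torus_pi (t i)) - atom k (x0 i)) -
    (c0 i * sigma i) *: (atom k (x0 i + torus_pi (t i)) - atom k (x0 i) - t i *: datom k (x0 i)).
  have L2b i : L2 (atom k (x0 i + torus_pi (t i)) - atom k (x0 i)) by exact: L2B.
  have L2r i : L2 (atom k (x0 i + torus_pi (t i)) - atom k (x0 i) - t i *: datom k (x0 i)).
    by apply: L2B => //; exact: L2Z.
  have L2e i : L2 (e i) by apply: L2B; exact: L2Z.
  set s := \sum_(i < n) _ in span.
  have L2s : L2 s by apply: L2_sum => i; apply: L2D; exact: L2Z.
  have L2ps : L2 (p0 - s) by exact: L2B.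
  have -> : \sum_(i < n) (c0 i * sigma i) *: atom k (x0 i) -
      \sum_(i < n) (c i * sigma i) *: atom k (x0 i + torus_pi (t i)) - l *: p0 =
      \sum_(i < n) e i - l *: (p0 - s).
    have eE i : e i = (c0 i * sigma i) *: atom k (x0 i) -
        (c i * sigma i) *: atom k (x0 i + torus_pi (t i)) -
        l *: (A i *: atom k (x0 i) + D i *: datom k (x0 i)).
      have cs : c i * sigma i = c0 i * sigma i - l * A i.
        rewrite /c mulrBl; congr (_ - _).
        transitivity (l * A i * (sigma i * sigma i)); first by ring.
        by rewrite (sign_sqr (sgn i)) mulr1.
      have ds : c0 i * sigma i * t i = - (l * D i).
        rewrite /t mulrN; congr (- _).
        transitivity (l * D i * (sigma i * sigma i)); first by field; rewrite gt_eqF.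
        by rewrite (sign_sqr (sgn i)) mulr1.
      rewrite cs; apply/funext => y; rewrite /e !fctE /GRing.scale/=.
      rewrite !mulrBr (mulrA _ (t i)) ds; ring.
    rewrite (eq_bigr _ (fun i _ => eE i)) !sumrB -scaler_sumr -/s scalerBr.
    by rewrite opprB addrA subrK.
  apply: le_trans (L2norm_triangleB _ _) _; [exact: L2_sum|exact: L2Z|].
  rewrite L2normZ// span mulr0 addr0.
  apply: le_trans (L2norm_sum L2e) _.
  have : \sum_(i < n) C1 i <= C by rewrite /C; move: S1 S2 S3 => /=; lra.
  move=> /(ler_wpM2r (sqr_ge0 l)); apply: le_trans; rewrite mulr_suml ler_sum// => i _.
  apply: le_trans (L2norm_triangleB _ _) _; [exact: L2Z|exact: L2Z|].
  rewrite !L2normZ// !normrM (sign_norm (sgn i)) mulr1 (gtr0_norm l0) (gtr0_norm (c0_gt0 i)).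
  have := L2_atomB kb (x0 i) (t i); have := L2_atom_taylor kC2 kb (x0 i) (t i).
  rewrite -(real_normK (num_real (t i))) tE => r1 r2.
  apply: (@le_trans _ _ (l * `|A i| * (B * (l * tau i)) + c0 i * (B * (l * tau i) ^+ 2))).
    by rewrite lerD// ler_wpM2l// ?mulr_ge0// ltW.
  by rewrite le_eqVlt; apply/orP; left; apply/eqP; rewrite /C1; ring.
- have : \sum_(i < n) C2 i <= C by rewrite /C; move: S1 S2 S3 => /=; lra.
  move=> /(ler_wpM2r (sqr_ge0 l)); apply: le_trans; rewrite mulr_suml ler_sum// => i _.
  have := Kpre_taylor kC2 kb (x0 i) (t i) L2p.
  rewrite min_norm_derive1 (contact_derive1 etaC2 min_norm_certificate_le1 sgn contact).
  rewrite mulr0 subr0 -(real_normK (num_real (t i))) tE => H.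
  rewrite (le_trans (ler_norm _))// normrM /C2 -(mulrA (c0 i + _)) ler_pM//.
    rewrite /c (le_trans (ler_normB _ _))// !normrM (sign_norm (sgn i)) mul1r (gtr0_norm (c0_gt0 i)).
    by rewrite lerD2l (gtr0_norm l0) ler_piMl.
  rewrite -(eta0_sigma i) -mulrBr normrM (sign_norm (sgn i)) mul1r distrC.
  by apply: le_trans H _; rewrite exprMn mulrA mulrAC.
Qed.

End min_norm_certificate.

(** * Minimization over combs close to the ground truth *)

Lemma cvg_dominated (R : realType) (T : Type) (F : set_system T) (N D : T -> R) (l : R) :
  Filter F -> (forall u, `|l - N u| <= D u) -> D u @[u --> F] --> 0 -> N u @[u --> F] --> l.
Proof.
move=> FF ND D0; apply/cvgrPdist_le => e e0.
have : \forall u \near F, D u < e by apply: (cvgr_lt _ D0).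
by apply: filterS => u /ltW; exact: le_trans.
Qed.

Section box_minimization.
Variables (R : realType) (k : torus R -> R) (B : R).
Hypotheses (kC2 : C2_torus k) (kb : expansion_bound k B).
Variables (n : nat) (c0 sigma : 'I_n -> R) (x0 : 'I_n -> torus R).
Hypothesis sgn : forall i, is_sign (sigma i).

Let B0 : 0 < B. Proof. by case: kb. Qed.

Definition shift (t : 'I_n -> R) i := x0 i + torus_pi (t i).

(** The primal objective with the total variation replaced by the sum of the
   amplitudes, which bounds it for nonnegative amplitudes. *)
Definition comb_objective (f : torus R -> R) (lambda : R) (c t : 'I_n -> R) : R :=
  2^-1 * L2norm (K k (dirac_comb c sigma (shift t)) - f) ^+ 2
  + lambda * \sum_(i < n) c i.

Lemma K_comb_lipschitz (c t c' t' : 'I_n -> R) :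
  L2norm (K k (dirac_comb c' sigma (shift t')) - K k (dirac_comb c sigma (shift t)))
  <= \sum_(i < n) (`|c' i| * (B * `|t' i - t i|) + `|c' i - c i| * B).
Proof.
rewrite !(K_comb kb) -sumrB.
have La := L2_atom kb.
have LB i : L2 (atom k (shift t' i) - atom k (shift t i)) by exact: L2B.
pose e i := (c' i * sigma i) *: (atom k (shift t' i) - atom k (shift t i)) +
  ((c' i - c i) * sigma i) *: atom k (shift t i).
have L2e i : L2 (e i) by apply: L2D; exact: L2Z.
rewrite (eq_bigr e) => [|i _]; last first.
  by apply/funext => y; rewrite /e !fctE /GRing.scale/=; ring.
apply: le_trans (L2norm_sum L2e) _; rewrite ler_sum// => i _.
apply: le_trans (L2norm_triangle _ _) _; [exact: L2Z|exact: L2Z|].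
rewrite !L2normZ// !normrM (sign_norm (sgn i)) !mulr1 lerD// ler_wpM2l//.
  have := L2_atomB kb (shift t i) (t' i - t i); congr (L2norm (_ - _) <= _).
  by rewrite /shift -addrA -torus_piD (addrC (t i)) subrK.
exact: L2norm_atom.
Qed.

(** Amplitudes and displacements are packed into one row vector, on which the
   box is compact and the objective continuous by [K_comb_lipschitz]. *)
Lemma box_minimizer (f : torus R -> R) (lambda a r : R) : L2 f -> 0 <= a -> 0 <= r ->
  exists c t : 'I_n -> R,
  [/\ forall i, `|c i - c0 i| <= a, forall i, `|t i| <= r &
      forall c' t', (forall i, `|c' i - c0 i| <= a) -> (forall i, `|t' i| <= r) ->
        comb_objective f lambda c t <= comb_objective f lambda c' t'].
Proof.
move=> L2f a0 r0.
pose C (v : 'rV[R]_(n + n)) i := v ord0 (lshift n i).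
pose T (v : 'rV[R]_(n + n)) i := v ord0 (rshift n i).
pose A (j : 'I_(n + n)) : set R := match fintype.split j with
  | inl i => `[c0 i - a, c0 i + a]%classic | inr i => `[- r, r]%classic end.
pose Q := [set v : 'rV[R]_(n + n) | forall j, A j (v ord0 j)].
have cQ : compact Q.
  by apply: rV_compact => j; rewrite /A; case: (fintype.split j) => i; exact: segment_compact.
pose pack (c t : 'I_n -> R) : 'rV[R]_(n + n) := \row_j
  match fintype.split j with inl i => c i | inr i => t i end.
have Cpack c t : C (pack c t) = c.
  by apply/funext => i; rewrite /C mxE (unsplitK (inl i)).
have Tpack c t : T (pack c t) = t.
  by apply/funext => i; rewrite /T mxE (unsplitK (inr i)).
have QE v : Q v <-> (forall i, `|C v i - c0 i| <= a) /\ (forall i, `|T v i| <= r).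
  split=> [Qv|[QC QT] j].
    split=> i.
      have := Qv (lshift n i); rewrite /A (unsplitK (inl i))/= in_itv/=.
      by rewrite ler_distl.
    have := Qv (rshift n i); rewrite /A (unsplitK (inr i))/= in_itv/=.
    by rewrite ler_norml.
  rewrite /A; case: (fintype.splitP j) => i ji /=; rewrite in_itv/=.
    by have := QC i; rewrite ler_distl /C (_ : lshift n i = j)//; exact: val_inj.
  by have := QT i; rewrite ler_norml /T (_ : rshift n i = j)//; exact: val_inj.
pose g v := K k (dirac_comb (C v) sigma (shift (T v))).
have L2g v : L2 (g v) by exact: (L2_K kb).
have coord j : continuous (fun v : 'rV[R]_(n + n) => v ord0 j) by exact: coord_continuous.
have cN : continuous (fun v => L2norm (g v - f)).
  move=> v0.
  pose D v := \sum_(i < n) (`|C v i| * (B * `|T v i - T v0 i|) + `|C v i - C v0 i| * B).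
  have D0 : D v0 = 0.
    by rewrite /D big1// => i _; rewrite !subrr normr0 !mulr0 mul0r addr0.
  have cD : D v @[v --> v0] --> D v0.
    suff limD (F : set_system 'rV[R]_(n + n)) : Filter F ->
        (forall i, C v i @[v --> F] --> C v0 i) ->
        (forall i, T v i @[v --> F] --> T v0 i) -> D v @[v --> F] --> D v0.
      by apply: (limD (nbhs v0) (nbhs_filter v0)) => i; exact: coord.
    move=> FF cC cT; apply: cvg_big => [|i _]; first exact: add_continuous.
    apply: cvgD; apply: cvgM => //; first exact: cvg_norm.
    - apply: cvgM; first exact: cvg_cst.
      by apply: cvg_norm; apply: cvgB => //; exact: cvg_cst.
    - by apply: cvg_norm; apply: cvgB => //; exact: cvg_cst.
    - exact: cvg_cst.
  rewrite D0 in cD; apply: (cvg_dominated (nbhs_filter v0) _ cD) => v.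
  apply: le_trans (L2norm_dist _ _) _; [exact: L2B|exact: L2B|].
  rewrite opprB addrA subrK -opprB L2normN; last exact: L2B.
  exact: K_comb_lipschitz.
have [||v Qv vmin] := @compact_EVT_min _ R
    (fun v => comb_objective f lambda (C v) (T v)) Q _ cQ.
- exists (pack c0 (fun=> 0)); apply/QE; rewrite Cpack Tpack.
  by split=> i; rewrite ?subrr normr0.
- apply: continuous_subspaceT => v.
  suff lim (F : set_system 'rV[R]_(n + n)) (N : 'rV[R]_(n + n) -> R) : Filter F ->
      (forall i, C u i @[u --> F] --> C v i) -> N u @[u --> F] --> N v ->
      2^-1 * N u ^+ 2 + lambda * (\sum_(i < n) C u i) @[u --> F] -->
      2^-1 * N v ^+ 2 + lambda * (\sum_(i < n) C v i).
    apply: (lim (nbhs v) (fun u => L2norm (g u - f)) (nbhs_filter v)); last exact: cN.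
    by move=> i; exact: coord.
  move=> FF cC cg; rewrite expr2; under eq_fun do rewrite expr2.
  apply: cvgD; apply: cvgM; do ?exact: cvg_cst; first exact: cvgM.
  by apply: cvg_big => [|i _]; [exact: add_continuous|exact: cC].
move: Qv; rewrite inE => /QE[QC QT].
exists (C v), (T v); split => // c' t' hc ht.
have := vmin (pack c' t'); rewrite Cpack Tpack; apply.
by rewrite inE; apply/QE; rewrite Cpack Tpack.
Qed.

End box_minimization.

(** * First-order conditions *)

Section first_order_conditions.
Variables (R : realType) (k : torus R -> R) (B : R).
Hypotheses (kC2 : C2_torus k) (kb : expansion_bound k B).
Variables (n : nat) (c0 sigma : 'I_n -> R) (x0 : 'I_n -> torus R).
Hypothesis sgn : forall i, is_sign (sigma i).
Variables (f : torus R -> R) (lambda a r : R) (c t : 'I_n -> R).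
Hypotheses (L2f : L2 f) (lambda_gt0 : 0 < lambda).
Hypothesis c_box : forall i, `|c i - c0 i| <= a.
Hypothesis t_box : forall i, `|t i| <= r.
Hypothesis c_t_min :
  forall c' t', (forall i, `|c' i - c0 i| <= a) -> (forall i, `|t' i| <= r) ->
  comb_objective k sigma x0 f lambda c t <= comb_objective k sigma x0 f lambda c' t'.

Local Notation img c t := (K k (dirac_comb c sigma (shift x0 t))).

Let B0 : 0 < B. Proof. by case: kb. Qed.

(** The candidate dual variable of a comb. *)
Definition residual := lambda^-1 *: (f - img c t).

Lemma L2_residual : L2 residual.
Proof. by apply: L2Z; apply: L2B => //; exact: (L2_K kb). Qed.

Lemma comb_objective_variation (c' t' : 'I_n -> R) D : L2 D -> img c' t' = img c t + D ->
  comb_objective k sigma x0 f lambda c' t' = comb_objective k sigma x0 f lambda c t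
    - lambda * L2inner residual D + 2^-1 * L2norm D ^+ 2
    + lambda * (\sum_(i < n) c' i - \sum_(i < n) c i).
Proof.
move=> L2D ctE; have L2i : L2 (img c t) by exact: (L2_K kb).
rewrite /comb_objective ctE (_ : img c t + D - f = (img c t - f) + D); last by rewrite addrAC.
have L2if : L2 (img c t - f) by exact: L2B.
rewrite L2norm_sqrD//.
have -> : L2inner (img c t - f) D = - (lambda * L2inner residual D).
  have L2fi : L2 (f - img c t) by exact: L2B.
  rewrite /residual L2innerZl// mulrA mulfV ?gt_eqF// mul1r.
  by rewrite -(opprB f) L2innerNl.
have alg (X Y I S' S : R) : 2^-1 * (X + 2 * - (lambda * I) + Y) + lambda * S' =
    2^-1 * X + lambda * S - lambda * I + 2^-1 * Y + lambda * (S' - S) by field.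
exact: alg.
Qed.

Definition bump (u : 'I_n -> R) i h j := u j + (if j == i then h else 0).

Lemma bump_box (u v : 'I_n -> R) i h (b : R) : (forall j, `|u j - v j| <= b) ->
  `|h| <= b - `|u i - v i| -> forall j, `|bump u i h j - v j| <= b.
Proof.
move=> ub hb j; rewrite /bump; case: eqP => [->|_]; last by rewrite addr0.
by rewrite addrAC; apply: le_trans (ler_normD _ _) _; rewrite -lerBrDl.
Qed.

Lemma sum_bump u i h : \sum_(j < n) bump u i h j = \sum_(j < n) u j + h.
Proof.
rewrite /bump big_split/=; congr (_ + _).
by rewrite (bigD1 i)//= eqxx big1 ?addr0// => j /negbTE ->.
Qed.

(** Stationarity in one amplitude: raising it costs [lambda] and gains
   [lambda] times the signed value of the certificate, up to second order. *)
Lemma interior_amplitude i : `|c i - c0 i| < a ->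
  sigma i * Kpre k residual (shift x0 t i) = 1.
Proof.
move=> ci; have L2r := L2_residual; have La := L2_atom kb.
suff : lambda * (1 - sigma i * Kpre k residual (shift x0 t i)) = 0.
  by move/eqP; rewrite mulf_eq0 gt_eqF//= subr_eq0 => /eqP <-.
pose s := a - `|c i - c0 i|; have s0 : 0 < s by rewrite subr_gt0.
apply: (@first_order_eq0 _ _ (2^-1 * B ^+ 2) s s0) => h hs.
have := c_t_min (bump_box c_box hs) t_box.
rewrite (@comb_objective_variation (bump c i h) t ((h * sigma i) *: atom k (shift x0 t i))); last 2 first.
- exact: L2Z.
- rewrite !(K_comb kb) [LHS](bigD1 i)//= [in RHS](bigD1 i)//= addrAC; congr (_ + _).
    by rewrite /bump eqxx -scalerDl mulrDl.
  by apply: eq_bigr => j /negbTE ji; rewrite /bump ji addr0.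
rewrite sum_bump L2innerZr//.
have -> : L2inner residual (atom k (shift x0 t i)) = Kpre k residual (shift x0 t i).
  by rewrite L2innerC.
rewrite L2normZ// exprMn real_normK ?num_real// exprMn.
have -> : sigma i ^+ 2 = 1 by rewrite expr2 sign_sqr.
have hB : L2norm (atom k (shift x0 t i)) ^+ 2 <= B ^+ 2.
  rewrite ler_pXn2r ?nnegrE ?L2norm_ge0 ?(ltW B0)//.
  exact: (L2norm_atom kb).
have alg (E l sg K0 N S b : R) : N <= b ->
    E <= E - l * (h * sg * K0) + 2^-1 * (h ^+ 2 * 1 * N) + l * (S + h - S) ->
    0 <= l * (1 - sg * K0) * h + 2^-1 * b * h ^+ 2.
  move=> Nb; have : h ^+ 2 * N <= h ^+ 2 * b by rewrite ler_wpM2l ?sqr_ge0.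
  by lra.
exact: alg.
Qed.

(** Stationarity in one position: a displacement changes the objective at
   first order by the derivative of the certificate alone. *)
Lemma interior_position i : 0 < c i -> `|t i| < r ->
  L2inner (datom k (shift x0 t i)) residual = 0.
Proof.
move=> ci ti; have L2r := L2_residual; have La := L2_atom kb.
suff : - (lambda * (c i * sigma i) * L2inner (datom k (shift x0 t i)) residual) = 0.
  move/eqP; rewrite oppr_eq0 !mulf_eq0 gt_eqF//= gt_eqF//=.
  by case: (sgn i) => ->; rewrite ?oppr_eq0 oner_eq0/= => /eqP.
pose s := r - `|t i|; have s0 : 0 < s by rewrite subr_gt0.
apply: (@first_order_eq0 _ _ (lambda * c i * (B * L2norm residual)
   + 2^-1 * (c i * B) ^+ 2) s s0) => h hs.
pose D := atom k (shift x0 t i + torus_pi h) - atom k (shift x0 t i).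
have L2D : L2 D by exact: L2B.
have sE : shift x0 (bump t i h) i = shift x0 t i + torus_pi h.
  by rewrite /shift /bump eqxx torus_piD addrA.
have t_box' j : `|bump t i h j| <= r.
  rewrite -[bump _ _ _ _]subr0; apply: (bump_box (v := fun=> 0)); first by move=> ?; rewrite subr0.
  by rewrite subr0.
have := c_t_min c_box t_box'.
rewrite (@comb_objective_variation c (bump t i h) ((c i * sigma i) *: D)); last 2 first.
- exact: L2Z.
- rewrite !(K_comb kb) [LHS](bigD1 i)//= [in RHS](bigD1 i)//= addrAC; congr (_ + _).
    by rewrite sE -scalerDr /D addrCA subrr addr0.
  by apply: eq_bigr => j /negbTE ji; rewrite /shift /bump ji addr0.
rewrite L2innerZr// L2normZ// normrM (sign_norm (sgn i)) mulr1 (gtr0_norm ci).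
have DB : (c i * L2norm D) ^+ 2 <= (c i * B) ^+ 2 * h ^+ 2.
  rewrite -(real_normK (num_real h)) -exprMn -mulrA.
  have c0' := ltW ci; have B0' := ltW B0.
  rewrite ler_pXn2r ?nnegrE ?mulr_ge0 ?L2norm_ge0//.
  by rewrite ler_wpM2l//; exact: (L2_atomB kb).
have := Kpre_taylor kC2 kb (shift x0 t i) h L2r.
have -> : Kpre k residual (shift x0 t i + torus_pi h) - Kpre k residual (shift x0 t i)
   = L2inner residual D.
  by rewrite L2innerC /D L2innerBl.
move=> T.
have {T} : `|lambda * (c i * sigma i) * (L2inner residual D - h * L2inner (datom k (shift x0 t i)) residual)|
    <= lambda * c i * (B * L2norm residual) * h ^+ 2.
  rewrite 3!normrM (sign_norm (sgn i)) mulr1 (gtr0_norm lambda_gt0) (gtr0_norm ci).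
  by rewrite -[leRHS]mulrA ler_wpM2l// mulr_ge0// ltW.
move: DB; clear.
have alg (E l cs I J N b e S : R) : N <= b * h ^+ 2 -> `|l * cs * (I - h * J)| <= e * h ^+ 2 ->
    E <= E - l * (cs * I) + 2^-1 * N + l * (S - S) ->
    0 <= - (l * cs * J) * h + (e + 2^-1 * b) * h ^+ 2.
  by rewrite ler_norml => Nb /andP[e1 e2] H; lra.
exact: alg.
Qed.

End first_order_conditions.

(** * Stability of the residual and of the spikes *)

Section stability.
Variables (R : realType) (k : torus R -> R) (B : R).
Hypotheses (kC2 : C2_torus k) (kb : expansion_bound k B).
Variables (n : nat) (c0 sigma : 'I_n -> R) (x0 : 'I_n -> torus R).
Let y0 := K k (dirac_comb c0 sigma x0).
Let p0 := xget (cst 0) (min_norm_dual_solution k y0).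
Let eta0 := min_norm_certificate k y0.
Hypothesis c0_gt0 : forall i, 0 < c0 i.
Hypothesis sgn : forall i, is_sign (sigma i).
Hypothesis contact : forall s x, is_sign s ->
  s * eta0 x = 1 <-> exists i, s = sigma i /\ x = x0 i.
Hypothesis etaC2 : C2_torus eta0.
Hypothesis curved : forall i, sigma i * torus_derive2 eta0 (x0 i) < 0.

Local Notation img c t := (K k (dirac_comb c sigma (shift x0 t))).
Local Notation res f lambda c t := (residual k sigma x0 f lambda c t).

Let B0 : 0 < B. Proof. by case: kb. Qed.
Let L2p0 : L2 p0.
Proof. exact: (min_norm_L2 kC2 kb sgn contact). Qed.
Let eta0_le1 x : `|eta0 x| <= 1.
Proof. exact: (min_norm_certificate_le1 kC2 kb sgn contact). Qed.

(** Completing the square around [lambda *: p0]: the duality gap of a comb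
   against [p0] appears as the last term. *)
Lemma comb_objective_gap f lambda (c t : 'I_n -> R) : L2 f ->
  comb_objective k sigma x0 f lambda c t =
  2^-1 * L2norm (f - img c t - lambda *: p0) ^+ 2 + lambda * L2inner f p0
  - 2^-1 * lambda ^+ 2 * L2norm p0 ^+ 2
  + lambda * \sum_(i < n) c i * (1 - sigma i * eta0 (shift x0 t i)).
Proof.
move=> L2f; have L2i : L2 (img c t) by exact: (L2_K kb).
have L2fi : L2 (f - img c t) by exact: L2B.
have L2l : L2 (lambda *: p0) by exact: L2Z.
rewrite /comb_objective -(opprB f) L2normN//.
rewrite [in RHS]L2norm_sqrD//; last exact: L2N.
rewrite [L2norm (- _)]L2normN// L2normZ// exprMn real_normK ?num_real//.
rewrite -scaleNr L2innerZr// L2innerBl//.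
have -> : L2inner (img c t) p0 = \sum_(i < n) c i * (sigma i * eta0 (shift x0 t i)).
  by rewrite (comb_pairing kC2 kb)//; apply: eq_bigr => i _; rewrite mulrA.
have -> : \sum_(i < n) c i * (1 - sigma i * eta0 (shift x0 t i)) =
    \sum_(i < n) c i - \sum_(i < n) c i * (sigma i * eta0 (shift x0 t i)).
  by rewrite -sumrB; apply: eq_bigr => i _; rewrite mulrBr mulr1.
have alg (X P S T I l : R) : 2^-1 * X + l * S = 2^-1 * (X + 2 * (- l * (I - T)) + l ^+ 2 * P)
   + l * I - 2^-1 * l ^+ 2 * P + l * (S - T) by field.
exact: alg.
Qed.

(** A comb that does at least as well as the competitor has a residual close
   to [p0]: by [comb_objective_gap] its objective controls the square of the
   distance, its own gap being nonnegative, while the competitor leaves only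
   the noise and terms of higher order in [lambda]. *)
Lemma residual_close (w : torus R -> R) lambda (alpha C : R) (c t c' t' : 'I_n -> R) :
  L2 w -> 0 < lambda -> L2norm w <= alpha * lambda -> (forall i, 0 <= c i) ->
  L2norm (y0 - img c' t' - lambda *: p0) <= C * lambda ^+ 2 ->
  \sum_(i < n) c' i * (1 - sigma i * eta0 (shift x0 t' i)) <= C * lambda ^+ 2 ->
  comb_objective k sigma x0 (y0 + w) lambda c t <=
    comb_objective k sigma x0 (y0 + w) lambda c' t' ->
  L2norm (res (y0 + w) lambda c t - p0) ^+ 2 <=
    (alpha + C * lambda) ^+ 2 + 2 * C * lambda.
Proof.
move=> L2w l0 wl cge0 y0c' gapc' cmin.
have L2y0 : L2 y0 by exact: (L2_K kb).
have L2f : L2 (y0 + w) by exact: L2D.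
have L2i u v : L2 (img u v) by exact: (L2_K kb).
have L2l : L2 (lambda *: p0) by exact: L2Z.
have rE : lambda *: (res (y0 + w) lambda c t - p0) = y0 + w - img c t - lambda *: p0.
  by rewrite scalerBr /residual scalerA mulfV ?gt_eqF// scale1r.
have L2r : L2 (res (y0 + w) lambda c t) by exact: (L2_residual kb).
have L2rp : L2 (res (y0 + w) lambda c t - p0) by exact: L2B.
have gap0 : 0 <= \sum_(i < n) c i * (1 - sigma i * eta0 (shift x0 t i)).
  apply: sumr_ge0 => i _; rewrite mulr_ge0// subr_ge0.
  exact: (sign_mul_le1 eta0_le1 sgn).
have close : L2norm (y0 + w - img c' t' - lambda *: p0) <= alpha * lambda + C * lambda ^+ 2.
  rewrite (_ : _ - _ = w + (y0 - img c' t' - lambda *: p0)); last first.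
    by rewrite (addrC y0) -!addrA.
  apply: le_trans (L2norm_triangle L2w (L2B (L2B L2y0 (L2i c' t')) L2l)) _.
  exact: lerD.
move: cmin; rewrite !(comb_objective_gap _ _ _ L2f) -rE (L2normZ _ L2rp) (gtr0_norm l0).
have : L2norm (y0 + w - img c' t' - lambda *: p0) ^+ 2 <= (alpha * lambda + C * lambda ^+ 2) ^+ 2.
  rewrite ler_pXn2r ?nnegrE ?L2norm_ge0//.
  exact: le_trans (L2norm_ge0 _) close.
have alg (N M I P S S' l al : R) : 0 < l -> M <= (al * l + C * l ^+ 2) ^+ 2 -> 0 <= S ->
    S' <= C * l ^+ 2 ->
    2^-1 * (l * N) ^+ 2 + l * I - 2^-1 * l ^+ 2 * P + l * S <=
    2^-1 * M + l * I - 2^-1 * l ^+ 2 * P + l * S' ->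
    N ^+ 2 <= (al + C * l) ^+ 2 + 2 * C * l.
  move=> lp HM HS HS' H; rewrite -(@ler_pM2l _ (l ^+ 2)) ?exprn_gt0//.
  have h1 : 0 <= l * S by rewrite mulr_ge0// ltW.
  have h2 : l * S' <= l * (C * l ^+ 2) by rewrite ler_pM2l.
  have -> : l ^+ 2 * ((al + C * l) ^+ 2 + 2 * C * l) =
    (al * l + C * l ^+ 2) ^+ 2 + 2 * (l * (C * l ^+ 2)) by ring.
  by rewrite -exprMn; lra.
by move=> HM; exact: alg.
Qed.

(** The second-order expansion survives a perturbation of [p0] that is small
   in L^2, so a critical contact near each spike is the only one there. *)
Lemma perturbed_certificate (ka r de theta : R) p (t : 'I_n -> R) :
  (forall i a b, `|a| <= r -> `|b| <= r ->
     sigma i * eta0 (x0 i + torus_pi b) <= sigma i * eta0 (x0 i + torus_pi a) +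
     (b - a) * (sigma i * torus_derive1 eta0 (x0 i + torus_pi a)) - ka * (b - a) ^+ 2) ->
  (forall i b, `|b| <= r -> 0 <= sigma i * eta0 (x0 i + torus_pi b)) ->
  (forall x, (forall i h, `|h| < r -> x <> x0 i + torus_pi h) -> `|eta0 x| <= 1 - de) ->
  B * theta < ka -> B * theta < de -> B * theta < 1 ->
  L2 p -> L2norm (p - p0) <= theta ->
  (forall i, `|t i| <= r) ->
  (forall i, sigma i * Kpre k p (shift x0 t i) = 1) ->
  (forall i, L2inner (datom k (shift x0 t i)) p = 0) ->
  (forall x, `|Kpre k p x| <= 1) /\
  forall x, `|Kpre k p x| = 1 -> exists i, x = shift x0 t i.
Proof.
move=> conc low gap tka tde t1 L2p pp0 tr tval tder.
have L2d : L2 (p - p0) by exact: L2B.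
have pE x : Kpre k p x = eta0 x + Kpre k (p - p0) x.
  by rewrite (KpreB kb)// addrC subrK.
have dB x : `|Kpre k (p - p0) x| <= B * theta.
  by apply: le_trans (Kpre_bound kb x L2d) _; rewrite ler_wpM2l// ltW.
suff key x : `|Kpre k p x| < 1 \/ (`|Kpre k p x| <= 1 /\ exists i, x = shift x0 t i).
  split=> x; first by case: (key x) => [/ltW|[]].
  by move=> x1; case: (key x) => [|[]//]; rewrite x1 ltxx.
have [[i [h [hr xE]]]|far] := pselect (exists i h, `|h| < r /\ x = x0 i + torus_pi h); last first.
  left; rewrite pE; apply: le_lt_trans (ler_normD _ _) _.
  have : `|eta0 x| <= 1 - de by apply: gap => i h hr xE; apply: far; exists i, h.
  have := dB x; lra.
have hr' := ltW hr.
have := conc i (t i) h (tr i) hr'; rewrite -xE -/(shift x0 t i).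
have := Kpre_taylor kC2 kb (shift x0 t i) (h - t i) L2d.
have -> : shift x0 t i + torus_pi (h - t i) = x.
  by rewrite xE /shift -addrA -torus_piD (addrC (t i)) subrK.
have L2a := L2_datom kC2 (shift x0 t i).
rewrite L2innerBr// tder sub0r (min_norm_derive1 kC2 kb sgn contact etaC2).
have tth : B * L2norm (p - p0) <= B * theta by rewrite ler_wpM2l// ltW.
move=> T Cc.
have {}T := le_trans T (ler_wpM2r (sqr_ge0 (h - t i)) tth).
have := low i h hr'; rewrite -xE => lx.
have := tval i; rewrite !pE => v1; move: (dB x) T.
rewrite !ler_norml !ltr_norml => /andP[d1 d2] /andP[T1 T2].
have [ht|ht] := eqVneq h (t i).
  right; split; last by exists i; rewrite xE ht.
  have xi : x = shift x0 t i by rewrite xE ht.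
  by apply/andP; rewrite xi; case: (sgn i) v1 => ->; split; lra.
have sq : 0 < (ka - B * theta) * (h - t i) ^+ 2.
  by rewrite mulr_gt0 ?subr_gt0// exprn_even_gt0//= subr_eq0.
left; apply/andP; move: Cc lx v1; case: (sgn i) => ->; split; lra.
Qed.

End stability.

Section perturbed_independence.
Variables (R : realType) (k : torus R -> R) (B : R).
Hypotheses (kC2 : C2_torus k) (kb : expansion_bound k B).
Variables (n : nat) (x0 : 'I_n -> torus R).
Hypothesis free : L2_linearly_independent (fun i => atom k (x0 i)).

Let B0 : 0 < B. Proof. by case: kb. Qed.

(** Atoms move in L^2 at most proportionally to their positions, so a small
   displacement is absorbed in the coefficient bound at the original points. *)
Lemma perturbed_independence : exists rC : R * R, [/\ 0 < rC.1, 0 < rC.2 &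
  forall t, (forall i, `|t i| <= rC.1) -> forall a : 'I_n -> R,
  \sum_(i < n) `|a i| <= rC.2 * L2norm (\sum_(i < n) a i *: atom k (shift x0 t i))].
Proof.
have La := L2_atom kb.
have [C C0 CP] := L2_independent_coef_bound (fun i => La (x0 i)) free.
pose N : R := n%:R + 1.
have N0 : 0 < N by rewrite ltr_wpDl.
have NC0 : 0 < N * C by rewrite mulr_gt0.
exists ((2 * (N * C * B))^-1, 2 * (N * C)); split => /=.
- by rewrite invr_gt0 !mulr_gt0.
- by rewrite mulr_gt0.
move=> t tr a.
set A := \sum_(i < n) `|a i|.
have A0 : 0 <= A by exact: sumr_ge0.
set S := \sum_(i < n) a i *: atom k (shift x0 t i).
have L2S : L2 S by apply: L2_sum => i; exact: L2Z.
have LB i : L2 (atom k (shift x0 t i) - atom k (x0 i)) by exact: L2B.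
pose e i := a i *: (atom k (shift x0 t i) - atom k (x0 i)).
have L2e i : L2 (e i) by exact: L2Z.
have S0E : \sum_(i < n) a i *: atom k (x0 i) = S - \sum_(i < n) e i.
  by rewrite /S -sumrB; apply: eq_bigr => i _; rewrite /e scalerBr opprB addrC subrK.
have S0N : L2norm (\sum_(i < n) a i *: atom k (x0 i)) <= L2norm S + (2 * (N * C))^-1 * A.
  rewrite S0E; apply: le_trans (L2norm_triangleB _ _) _ => //; first exact: L2_sum.
  rewrite lerD2l; apply: le_trans (L2norm_sum L2e) _.
  rewrite /A mulr_sumr ler_sum// => i _; rewrite /e L2normZ// mulrC ler_wpM2r//.
  apply: le_trans (L2_atomB kb _ _) _.
  apply: le_trans (ler_wpM2l (ltW B0) (tr i)) _.
  rewrite le_eqVlt; apply/orP; left; apply/eqP; field.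
  by rewrite !gt_eqF.
have : A <= N * (C * (L2norm S + (2 * (N * C))^-1 * A)).
  have Ai i : `|a i| <= C * (L2norm S + (2 * (N * C))^-1 * A).
    by apply: le_trans (CP a i) _; rewrite ler_wpM2l// ltW.
  apply: le_trans (ler_sum _ (fun i _ => Ai i)) _.
  rewrite sumr_const card_ord -[leLHS]mulr_natl ler_wpM2r//; last by rewrite lerDl.
  by rewrite mulr_ge0 ?addr_ge0 ?mulr_ge0 ?invr_ge0 ?L2norm_ge0// ltW// mulr_gt0.
have -> : N * (C * (L2norm S + (2 * (N * C))^-1 * A)) = N * C * L2norm S + A / 2.
  by field; rewrite !gt_eqF.
lra.
Qed.

End perturbed_independence.

(** * Optimality of a certified comb *)

Section certified_comb.
Variables (R : realType) (k : torus R -> R) (B : R).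
Hypotheses (kC2 : C2_torus k) (kb : expansion_bound k B).
Variables (n : nat) (c sigma : 'I_n -> R) (x : 'I_n -> torus R).
Variables (y0 w p : torus R -> R) (lambda C : R).
Hypotheses (L2y0 : L2 y0) (L2w : L2 w) (L2p : L2 p) (lambda_gt0 : 0 < lambda).
Hypothesis c_gt0 : forall i, 0 < c i.
Hypothesis sgn : forall i, is_sign (sigma i).
Hypothesis residualE : y0 + w - K k (dirac_comb c sigma x) = lambda *: p.
Hypothesis p_le1 : forall z, `|Kpre k p z| <= 1.
Hypothesis p_contact : forall z, `|Kpre k p z| = 1 -> exists i, z = x i.
Hypothesis p_sigma : forall i, sigma i * Kpre k p (x i) = 1.
Hypothesis free : forall a : 'I_n -> R,
  \sum_(i < n) `|a i| <= C * L2norm (\sum_(i < n) a i *: atom k (x i)).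

Local Notation u := (dirac_comb c sigma x).

Let L2K v : L2 (K k v). Proof. exact: (L2_K kb). Qed.
Let feas : dual_feasible k p. Proof. exact/(dual_feasibleP kb). Qed.

Lemma free_coef_eq0 a : L2norm (\sum_(i < n) a i *: atom k (x i)) = 0 ->
  forall i, a i = 0.
Proof.
move=> a0 i; have := free a; rewrite a0 mulr0 (bigD1 i)//= => H.
apply/eqP; rewrite -normr_le0; apply: le_trans H.
by rewrite lerDl sumr_ge0.
Qed.

Lemma certified_points_inj : injective x.
Proof.
move=> i j ij; apply/eqP/negP => /negP neq.
have : (1 : R) = 0; last by move/eqP; rewrite oner_eq0.
pose a l : R := if l == i then 1 else if l == j then -1 else 0.
suff a0 : \sum_(l < n) a l *: atom k (x l) = 0.
  rewrite -(_ : a i = 1); last by rewrite /a eqxx.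
  apply: free_coef_eq0; rewrite a0.
  by apply/eqP; rewrite -sqrf_eq0 L2norm_sqr ?L2inner0l//; exact: L20.
rewrite (bigD1 i)//= (bigD1 j)//=; last by rewrite eq_sym.
rewrite big1 => [|l /andP[/negbTE li /negbTE lj]]; last by rewrite /a li lj scale0r.
by rewrite /a eqxx eq_sym (negbTE neq) eqxx ij scale1r scaleN1r addr0 subrr.
Qed.

Lemma certified_pairing : L2inner (K k u) p = \sum_(i < n) c i.
Proof.
rewrite (comb_pairing kC2 kb)//; apply: eq_bigr => i _.
by rewrite -mulrA p_sigma mulr1.
Qed.

Lemma certified_tv : tv_norm u <= \sum_(i < n) c i.
Proof.
apply: le_trans (tv_norm_comb _ _ _) _; rewrite ler_sum// => i _.
by rewrite normrM (sign_norm (sgn i)) mulr1 gtr0_norm.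
Qed.

(** The certified comb beats [v] by a strong convexity term and by the duality
   gap of [v] against [p]. *)
Lemma primal_objective_gap v :
  primal_objective k y0 lambda w u + 2^-1 * L2norm (K k v - K k u) ^+ 2 +
    lambda * (tv_norm v - L2inner (K k v) p) <= primal_objective k y0 lambda w v.
Proof.
rewrite /primal_objective.
have -> : (K k u \- y0 \- w) = - (lambda *: p).
  by rewrite -residualE opprB opprD addrA.
have -> : (K k v \- y0 \- w) = (K k v - K k u) - lambda *: p.
  by rewrite -residualE; apply/funext => z /=; rewrite !fctE; ring.
have L2l : L2 (lambda *: p) by exact: L2Z.
have L2v : L2 (K k v - K k u) by exact: L2B.
rewrite (L2norm_sqrD L2v (L2N L2l)) (L2normN L2l) -scaleNr L2innerZr// L2innerBl//.
rewrite certified_pairing.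
have alg (X Y T U S I : R) : U <= S ->
    2^-1 * Y + lambda * U + 2^-1 * X + lambda * (T - I) <=
    2^-1 * (X + 2 * (- lambda * (I - S)) + Y) + lambda * T.
  move=> US; have : lambda * U <= lambda * S by rewrite ler_pM2l.
  lra.
exact: alg certified_tv.
Qed.

Lemma certified_primal : primal_solution k y0 lambda w u.
Proof.
move=> v; apply: le_trans (primal_objective_gap v).
rewrite -addrA lerDl addr_ge0//; first by rewrite mulr_ge0// sqr_ge0.
by rewrite mulr_ge0// ?subr_ge0; [exact: ltW|exact: (dual_feasible_pairing kC2 kb)].
Qed.

(** Another solution has the same image and no duality gap.  The latter puts it
   on the contact points of the certificate, and independence of the atoms
   then leaves no choice for the amplitudes. *)
Lemma certified_primal_unique v : primal_solution k y0 lambda w v -> eq_radon v u.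
Proof.
move=> /(_ u) vmin; have := le_trans (primal_objective_gap v) vmin.
have d0 : 0 <= tv_norm v - L2inner (K k v) p.
  by rewrite subr_ge0; exact: (dual_feasible_pairing kC2 kb).
have N0 : 0 <= L2norm (K k v - K k u) ^+ 2 by rewrite sqr_ge0.
have alg (J N d : R) : 0 <= N -> 0 <= d -> J + 2^-1 * N + lambda * d <= J -> N = 0 /\ d = 0.
  move=> N0' d0'; have ld : 0 <= lambda * d by rewrite mulr_ge0// ltW.
  move=> H; have ld0 : lambda * d = 0 by lra.
  split; first by lra.
  by move/eqP: ld0; rewrite mulf_eq0 gt_eqF//= => /eqP.
move=> /(alg _ _ _ N0 d0)[/eqP]; rewrite sqrf_eq0 => /eqP N00 d00.
have vle : tv_norm v <= cintegral v (Kpre k p).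
  by rewrite -(K_adjoint kC2 kb)// -subr_le0 d00.
have [a va] := extremal_measure_comb (Kpre_continuous kb L2p) p_le1
  certified_points_inj p_contact vle.
have Kv : K k v = K k (dirac_comb a (fun=> 1) x).
  apply/funext => s; apply: eq_radon_cintegral => //.
  apply: continuous_bounded_measurable; exact: (continuous_translate kb).
have ac i : a i - c i * sigma i = 0.
  apply: (@free_coef_eq0 (fun i => a i - c i * sigma i)).
  rewrite -[RHS]N00 Kv !(K_comb kb) -sumrB; congr L2norm.
  by apply: eq_bigr => j _; rewrite mulr1 scalerBl.
move=> A mA; rewrite va// !dirac_combE; apply: eq_bigr => i _.
by rewrite mulr1 (subr0_eq (ac i)).
Qed.

(** The dual objective at a feasible [q] falls short of that at [p] by a
   multiple of the squared norm of [q - p], so all maximizers have the same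
   certificate. *)
Lemma certified_noisy_certificate z : noisy_certificate k y0 lambda w z = Kpre k p z.
Proof.
have L2f : L2 (y0 \+ w) by exact: L2D.
have objE q : L2 q -> noisy_dual_objective y0 lambda w q =
    2^-1 * lambda ^+ 2 * L2norm p ^+ 2 - 2^-1 * lambda ^+ 2 * L2norm (q - p) ^+ 2
    + lambda * L2inner (K k u) q.
  move=> L2q; rewrite /noisy_dual_objective.
  have -> : y0 \+ w = lambda *: p + K k u by rewrite -residualE subrK.
  have L2l : L2 (lambda *: p) by exact: L2Z.
  rewrite L2innerDl// L2innerZl// (L2norm_sqrD L2q (L2N L2p)) (L2normN L2p).
  rewrite (L2innerC q (- p)) L2innerNl//.
  have alg (I S P Q : R) : lambda * (lambda * I + S) - lambda ^+ 2 / 2 * Q =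
     2^-1 * lambda ^+ 2 * P - 2^-1 * lambda ^+ 2 * (Q + 2 * - I + P) + lambda * S by field.
  exact: alg.
have Kuq q : dual_feasible k q -> L2inner (K k u) q <= \sum_(i < n) c i.
  move=> fq; apply: le_trans certified_tv.
  exact: (dual_feasible_pairing kC2 kb).
have N00 : L2norm (p - p) = 0.
  by rewrite subrr; apply/eqP; rewrite -sqrf_eq0 L2norm_sqr ?L2inner0l//; exact: L20.
have alg (P N S T : R) : 0 <= N -> S <= T ->
   2^-1 * lambda ^+ 2 * P - 2^-1 * lambda ^+ 2 * N + lambda * S <=
   2^-1 * lambda ^+ 2 * P - 2^-1 * lambda ^+ 2 * 0 + lambda * T.
  move=> N0 ST; have : lambda * S <= lambda * T by rewrite ler_pM2l.
  have : 0 <= lambda ^+ 2 * N by rewrite mulr_ge0// sqr_ge0.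
  lra.
have sol : noisy_dual_solution k y0 lambda w p.
  split=> // q fq; have L2q : L2 q by case: fq.
  rewrite !objE// N00 expr0n/= certified_pairing; apply: alg; last exact: Kuq.
  exact: sqr_ge0.
have [fq qmax] : noisy_dual_solution k y0 lambda w
    (xget (cst 0) (noisy_dual_solution k y0 lambda w)) by apply: xgetPex; exists p.
rewrite /noisy_certificate; set q := xget _ _ in fq qmax *.
have L2q : L2 q by case: fq.
have L2qp : L2 (q - p) by exact: L2B.
have qp : L2norm (q - p) = 0.
  apply/eqP; rewrite -sqrf_eq0 eq_le sqr_ge0 andbT.
  have := qmax p feas; rewrite !objE// N00 expr0n/= certified_pairing.
  have := Kuq q fq; have alg' (P N S T : R) : S <= T ->
    2^-1 * lambda ^+ 2 * P - 2^-1 * lambda ^+ 2 * 0 + lambda * T <=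
    2^-1 * lambda ^+ 2 * P - 2^-1 * lambda ^+ 2 * N + lambda * S -> N <= 0.
    move=> ST; have : lambda * S <= lambda * T by rewrite ler_pM2l.
    move=> h1 h2; have : lambda ^+ 2 * N <= 0 by lra.
    by rewrite pmulr_rle0// exprn_gt0.
  exact: alg'.
apply/eqP; rewrite -subr_eq0 -(KpreB kb)// -normr_le0.
by apply: le_trans (Kpre_bound kb z L2qp) _; rewrite qp mulr0.
Qed.

End certified_comb.

(** * The metric on signed point masses *)

Section signed_dirac_metric.
Variables (R : realType) (dB : radon R -> radon R -> R).
Hypothesis dB_metric : metrizes_weak_star dB.

Lemma signed_diracs_sdirac s (x : torus R) : is_sign s -> signed_diracs (sdirac s x).
Proof. by move=> ss; exists s, x. Qed.

Lemma sdiracE s (x : torus R) A : sdirac s x A = (s%:E * \d_x A)%E.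
Proof. by []. Qed.

Lemma sdirac_dist_gt0 s s' (x x' : torus R) : is_sign s -> is_sign s' -> x <> x' ->
  0 < dB (sdirac s x) (sdirac s' x').
Proof.
move=> ss ss' xx'; have [d0 _ _ _] := dB_metric.
have [dge0 deq] := d0 _ _ (signed_diracs_sdirac x ss) (signed_diracs_sdirac x' ss').
rewrite lt_def dge0 andbT; apply/eqP => /deq/(_ [set x] (measurable_torus1 x)).
rewrite !sdiracE !diracE mem_set//= mule1.
rewrite memNset ?mule0 => [[]|/= /esym//].
by case: ss => -> /eqP; rewrite ?oppr_eq0 oner_eq0.
Qed.

(** Point masses depend continuously on the position for the weak* topology;
   a sequence contradicting the claim would converge. *)
Lemma sdirac_ball s (x : torus R) (eps : R) : is_sign s -> 0 < eps ->
  exists2 r : R, 0 < r & forall t, `|t| <= r ->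
    dirac_ball dB (sdirac s x) eps (sdirac s (x + torus_pi t)).
Proof.
move=> ss eps0; apply: contrapT => nr.
have far m : exists t, `|t| <= m.+1%:R^-1 /\ eps < dB (sdirac s (x + torus_pi t)) (sdirac s x).
  apply: contrapT => nt; apply: nr; exists m.+1%:R^-1; first by rewrite invr_gt0.
  move=> t tm; split; first exact: signed_diracs_sdirac.
  by rewrite leNgt; apply/negP => H; apply: nt; exists t.
have /choice[t tP] := far.
have t0 : t m @[m --> \oo] --> (0 : R).
  apply/norm_cvg0P; apply: (@squeeze_cvgr _ _ _ _ (fun=> 0) (fun m => m.+1%:R^-1)).
  - by apply: nearW => m; rewrite normr_ge0 (tP m).1.
  - exact: cvg_cst.
  - exact: cvg_harmonic.
have [_ _ _ dcvg] := dB_metric.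
have /dcvg : forall m, signed_diracs (sdirac s (x + torus_pi (t m))).
  by move=> m; exact: signed_diracs_sdirac.
move=> /(_ (sdirac s x) (signed_diracs_sdirac x ss)) [_ wd].
have : weak_star_cvg (fun m => sdirac s (x + torus_pi (t m))) (sdirac s x).
  move=> f fc; have bf := continuous_bounded_measurable fc.
  rewrite cintegral_sdirac//; under eq_fun do rewrite cintegral_sdirac//.
  apply: cvgM; first exact: cvg_cst.
  pose g (h : R) := f (x + torus_pi h).
  have gc : continuous g.
    move=> h; rewrite (_ : g = periodic_lift f \o (fun h => repr x + h)).
      apply: continuous_comp; last exact: continuous_lift.
      by apply: cvgD; [exact: cvg_cst|exact: cvg_id].
    by apply/funext => h'; rewrite /g /periodic_lift/= torus_piD torus_pi_repr.
  have -> : f x = g 0 by rewrite /g torus_pi0 addr0.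
  exact: (cvg_comp _ _ t0 (gc 0)).
move/wd => /cvgr_lt /(_ _ eps0) [N _ HN].
by have := lt_trans (tP N).2 (HN N (leqnn N)); rewrite ltxx.
Qed.

End signed_dirac_metric.

(** * Exact support recovery *)

Lemma small_parameters (R : realType) (a r theta C2 D : R) :
  0 < a -> 0 < r -> 0 < theta -> 0 < C2 -> 0 < D ->
  exists2 lambda0 : R, 0 < lambda0 & forall lambda, 0 < lambda <= lambda0 ->
  [/\ lambda <= 1, C2 * lambda <= a, C2 * lambda <= r, D * lambda <= a / 4 &
      (theta / 2 + C2 * lambda) ^+ 2 + 2 * C2 * lambda <= theta ^+ 2].
Proof.
move=> a0 r0 th0 C20 D0.
(* each requirement is granted an eighth of the smallest margin *)
pose m := Num.min (Num.min 1 a) (Num.min r (Num.min theta (theta ^+ 2))).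
have m0 : 0 < m by rewrite !lt_min ltr01 a0 r0 th0 exprn_gt0.
have Q0 : 0 < 8 * (1 + C2 + D) by rewrite mulr_gt0// !addr_gt0.
exists (m / (8 * (1 + C2 + D))); first by rewrite divr_gt0.
move=> l /andP[l0]; rewrite ler_pdivlMr// => lm.
have mm : m <= m by [].
rewrite {2}/m !le_min in mm; move: mm => /andP[/andP[m1 ma] /andP[mr /andP[mt mt2]]].
have Cl : 0 < C2 * l by rewrite mulr_gt0.
have Dl : 0 < D * l by rewrite mulr_gt0.
have sum : 8 * l + 8 * (C2 * l) + 8 * (D * l) <= m.
  by move: lm; clear; lra.
split; try lra.
have : C2 * l * (C2 * l) <= theta / 8 * (theta / 8) by apply: ler_pM; lra.
have : C2 * l * theta <= theta / 8 * theta by apply: ler_wpM2r; lra.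
by move: mt2; rewrite !expr2; lra.
Qed.

Section recovery.
Variables (R : realType) (k : torus R -> R).
Variables (n : nat) (c0 sigma : 'I_n -> R) (x0 : 'I_n -> torus R).
Let y0 := K k (dirac_comb c0 sigma x0).
Let eta0 := min_norm_certificate k y0.
Hypothesis kC2 : C2_torus k.
Hypothesis c0_gt0 : forall i, 0 < c0 i.
Hypothesis sgn : forall i, is_sign (sigma i).
Hypothesis contact : forall s x, is_sign s ->
  s * eta0 x = 1 <-> exists i, s = sigma i /\ x = x0 i.
Hypothesis etaC2 : C2_torus eta0.
Hypothesis curved : forall i, sigma i * torus_derive2 eta0 (x0 i) < 0.
Hypothesis free : L2_linearly_independent (fun i => atom k (x0 i)).

(** The constants are chosen in this order: a box, of radius [a] for the
   amplitudes and [r] for the displacements; the gap [de] of the certificate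
   outside arcs of radius [r]; the accuracy [th] to which the residual must
   approximate [p0] for the certificate to keep its shape; and a noise level
   that guarantees this accuracy and keeps the minimizer inside the box. *)
Lemma support_recovery (eps rho : R) : 0 < eps -> 0 < rho ->
  exists alpha lambda0 : R, [/\ 0 < alpha, 0 < lambda0 &
  forall lambda w, noise_region alpha lambda0 (lambda, w) -> 0 < lambda ->
  exists c t : 'I_n -> R, let x := shift x0 t in
    [/\ (forall i, [/\ 0 < c i, `|c i - c0 i| <= eps & `|t i| <= rho]),
        injective x,
        (forall i, sigma i * noisy_certificate k y0 lambda w (x i) = 1),
        (forall z, `|noisy_certificate k y0 lambda w z| = 1 -> exists i, z = x i) &
        primal_solution k y0 lambda w (dirac_comb c sigma x) /\
        forall v, primal_solution k y0 lambda w v ->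
          eq_radon v (dirac_comb c sigma x)]].
Proof.
move=> eps0 rho0.
have [B kb] := C2_torus_expansion kC2.
have B0 : 0 < B by case: kb.
have eta1 := min_norm_certificate_le1 kC2 kb sgn contact.
have [[r1 C1] [/= r10 C10 pert]] := perturbed_independence kb free.
have [[ka r2] [/= ka0 r20 conc low]] := certificate_curvature etaC2 sgn contact curved.
have [C2 C20 comp] := first_order_competitor kC2 kb c0_gt0 sgn contact etaC2 curved.
have L2p0 := min_norm_L2 kC2 kb sgn contact.
set p0 := xget _ _ in comp L2p0.
have L2y0 : L2 y0 by exact: (L2_K kb).
have [cm cm0 cmP] := positive_lower_bound c0_gt0.
pose a := Num.min eps (cm / 2).
have a0 : 0 < a by rewrite lt_min eps0 divr_gt0.
have a_eps : a <= eps by rewrite ge_min lexx.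
have a_cm : a <= cm / 2 by rewrite ge_min lexx orbT.
pose S0 := \sum_(i < n) c0 i.
have S00 : 0 <= S0 by apply: sumr_ge0 => i _; exact: ltW.
pose E := C1 * (B * S0 + 1).
have E0 : 0 < E by rewrite mulr_gt0// ltr_wpDl// mulr_ge0// ltW.
pose r := Num.min (Num.min rho r1) (Num.min r2 (a / (4 * E))).
have r0 : 0 < r by rewrite !lt_min rho0 r10 r20 divr_gt0// mulr_gt0.
have rr : r <= r by [].
rewrite {2}/r !le_min in rr; move: rr => /andP[/andP[r_rho r_r1] /andP[r_r2 rE]].
have rS : C1 * (B * S0 * r) <= a / 4.
  have : E * r <= a / 4.
    rewrite ler_pdivlMr// (_ : E * r * 4 = r * (4 * E)); last by ring.
    by rewrite -ler_pdivlMr// mulr_gt0.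
  by apply: le_trans; rewrite /E -[leRHS]mulrA ler_wpM2l ?(ltW C10)// ler_wpM2r ?(ltW r0)// lerDl.
have [de de0 gap] := certificate_gap etaC2 eta1 contact r0.
pose th := Num.min (Num.min ka de) (Num.min 1 (ka * r ^+ 2)) / (2 * B).
have mth : 0 < Num.min (Num.min ka de) (Num.min 1 (ka * r ^+ 2)).
  by rewrite !lt_min ka0 de0 ltr01 mulr_gt0// exprn_gt0.
have th0 : 0 < th by rewrite divr_gt0// mulr_gt0.
have Bth : B * th < Num.min (Num.min ka de) (Num.min 1 (ka * r ^+ 2)).
  have -> : B * th = Num.min (Num.min ka de) (Num.min 1 (ka * r ^+ 2)) / 2.
    by rewrite /th; field; rewrite gt_eqF.
  by rewrite ltr_pdivrMr// ltr_pMr// ltr1n.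
move: Bth; rewrite !lt_min => /andP[/andP[Bka Bde] /andP[B1 Br]].
pose D := C1 * (th / 2 + L2norm p0 + th) + 1.
have D0 : 0 < D.
  have P0 := L2norm_ge0 p0; have th' : 0 <= th / 2 + L2norm p0 + th.
    by move: P0 th0; clear; move: (L2norm p0) => P; lra.
  by rewrite ltr_wpDl// mulr_ge0// ltW.
have [l0 l00 small] := small_parameters a0 r0 th0 C20 D0.
exists (th / 2), l0; split; [exact: divr_gt0|by []|] => lambda w [/= /andP[_ ll0] L2w wl] lgt0.
have [|l1 lC2a lC2r lD lth] := small lambda; first by rewrite lgt0.
have [|c' [t' [c'box t'box y0c' gapc']]] := comp lambda; first by rewrite lgt0.
have L2f : L2 (y0 + w) by exact: L2D.
have [c [t [cbox tbox cmin]]] := box_minimizer kb c0 x0 sgn lambda L2f (ltW a0) (ltW r0).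
have c_gt0 i : 0 < c i.
  have := cbox i; rewrite ler_distl => /andP[h _]; have := cmP i; lra.
pose p := residual k sigma x0 (y0 + w) lambda c t.
have L2p : L2 p by exact: (L2_residual kb).
have pE : y0 + w - K k (dirac_comb c sigma (shift x0 t)) = lambda *: p.
  by rewrite /p /residual scalerA mulfV ?gt_eqF// scale1r.
have pp0 : L2norm (p - p0) <= th.
  rewrite -(@ler_pXn2r _ 2)// ?nnegrE ?L2norm_ge0 ?(ltW th0)//.
  apply: le_trans lth.
  apply: (residual_close kC2 kb sgn contact L2w lgt0 wl _ y0c' gapc').
    by move=> i; exact: ltW.
  by apply: cmin => i; [exact: le_trans (c'box i) lC2a|exact: le_trans (t'box i) lC2r].
have L2pp : L2 (p - p0) by exact: L2B.
have tr1 i : `|t i| <= r1 by exact: le_trans (tbox i) r_r1.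
have free_t := pert t tr1.
(* the atoms reproduce [y0] up to the noise, the fidelity and the displacements *)
have camp i : `|c i - c0 i| < a.
  pose G := K k (dirac_comb c0 sigma (shift x0 t)).
  have L2G : L2 G by exact: (L2_K kb).
  have GE : L2norm (G - y0) <= B * S0 * r.
    have shift0 : shift x0 (fun=> 0) = x0.
      by apply/funext => j; rewrite /shift torus_pi0 addr0.
    have := K_comb_lipschitz kb x0 sgn c0 (fun=> 0) c0 t.
    rewrite shift0 => /le_trans; apply.
    rewrite (mulrAC B) mulr_sumr ler_sum// => j _.
    rewrite subrr normr0 mul0r addr0 subr0 (gtr0_norm (c0_gt0 j)) mulrC.
    by rewrite ler_wpM2r ?(ltW (c0_gt0 j))// ler_wpM2l// ltW.
  have := free_t (fun j => (c j - c0 j) * sigma j).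
  have -> : \sum_(j < n) ((c j - c0 j) * sigma j) *: atom k (shift x0 t j) =
      (w - lambda *: p) - (G - y0).
    rewrite -pE /G !(K_comb kb) opprB opprB.
    rewrite (eq_bigr (fun j => (c j * sigma j) *: atom k (shift x0 t j) -
       (c0 j * sigma j) *: atom k (shift x0 t j))); last first.
      by move=> j _; rewrite mulrBl scalerBl.
    rewrite sumrB; apply/funext => z; rewrite !fctE; ring.
  have pN : L2norm p <= L2norm p0 + th.
    have -> : p = p0 + (p - p0) by rewrite addrC subrK.
    by apply: le_trans (L2norm_triangle L2p0 L2pp) _; rewrite lerD2l.
  have L2l : L2 (lambda *: p) by exact: L2Z.
  have N1 : L2norm (w - lambda *: p - (G - y0)) <=
      th / 2 * lambda + lambda * (L2norm p0 + th) + B * S0 * r.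
    apply: le_trans (L2norm_triangleB _ _) _; [exact: L2B|exact: L2B|].
    apply: lerD => //; apply: le_trans (L2norm_triangleB _ _) _ => //.
    by rewrite L2normZ// (gtr0_norm lgt0) lerD// ler_wpM2l// ltW.
  move=> /le_trans/(_ (ler_wpM2l (ltW C10) N1)).
  have ci : `|c i - c0 i| <= \sum_(j < n) `|(c j - c0 j) * sigma j|.
    by rewrite (bigD1 i)//= normrM (sign_norm (sgn i)) mulr1 lerDl sumr_ge0.
  move=> /(le_trans ci) H; apply: le_lt_trans H _.
  have : C1 * (th / 2 + L2norm p0 + th) * lambda <= a / 4.
    by apply: le_trans lD; rewrite ler_wpM2r ?(ltW lgt0)// lerDl.
  move: rS a0; clear.
  by move: (L2norm p0) => P; lra.
have psig i : sigma i * Kpre k p (shift x0 t i) = 1.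
  exact: (interior_amplitude kb sgn L2f lgt0 cbox tbox cmin).
(* at distance [r] the minimal-norm certificate is too far below 1 *)
have pos i : `|t i| < r.
  have := conc i 0 (t i); rewrite normr0 => /(_ (ltW r20) (le_trans (tbox i) r_r2)).
  rewrite torus_pi0 addr0 (contact_derive1 etaC2 eta1 sgn contact) (contact_value sgn contact).
  rewrite !mulr0 addr0 subr0 -/(shift x0 t i).
  have := Kpre_bound kb (shift x0 t i) L2pp; rewrite (KpreB kb)//.
  have := psig i; rewrite -/(eta0 _) => ps.
  move=> Kb; have {Kb} : `|Kpre k p (shift x0 t i) - eta0 (shift x0 t i)| <= B * th.
    by apply: le_trans Kb _; rewrite ler_wpM2l// ltW.
  rewrite ler_norml => /andP[k1 k2] eb.
  have : ka * t i ^+ 2 < ka * r ^+ 2.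
    by apply: le_lt_trans Br; move: ps eb; case: (sgn i) => ->; lra.
  rewrite ltr_pM2l// -(real_normK (num_real (t i))) ltr_pXn2r// ?nnegrE//.
  exact: ltW.
have pder i : L2inner (datom k (shift x0 t i)) p = 0.
  exact: (interior_position kC2 kb sgn L2f lgt0 cbox tbox cmin (c_gt0 i) (pos i)).
have [ple1 pcont] : (forall x, `|Kpre k p x| <= 1) /\
    forall x, `|Kpre k p x| = 1 -> exists i, x = shift x0 t i.
  apply: (perturbed_certificate kC2 kb sgn contact etaC2 (ka := ka) (r := r) (de := de) (theta := th)) => //.
  - by move=> i a' b' ha hb; apply: conc; [exact: le_trans ha r_r2|exact: le_trans hb r_r2].
  - by move=> i b' hb; apply: low; exact: le_trans hb r_r2.
have noisyE := certified_noisy_certificate kC2 kb L2y0 L2w L2p lgt0 c_gt0 sgn pE ple1 psig.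
exists c, t => /=; split.
- by move=> i; split; [exact: c_gt0|exact: le_trans (cbox i) a_eps|exact: le_trans (tbox i) r_rho].
- exact: (certified_points_inj free_t).
- by move=> i; rewrite noisyE.
- by move=> z; rewrite noisyE; exact: pcont.
- split; first exact: (certified_primal kC2 kb L2p lgt0 c_gt0 sgn pE ple1 psig).
  exact: (certified_primal_unique kC2 kb L2p lgt0 c_gt0 sgn pE ple1 pcont psig free_t).
Qed.

End recovery.

Theorem theorem6p6 (R : realType) (k : torus R -> R)
  (dB : radon R -> radon R -> R)
  (n : nat) (c0 sigma : 'I_n -> R) (x0 : 'I_n -> torus R)
  (u0 := dirac_comb c0 sigma x0)
  (y0 := K k u0)
  (eta0 := min_norm_certificate k y0) :
  C2_torus k ->
  metrizes_weak_star dB ->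
  (forall i, 0 < c0 i) ->
  (forall i, is_sign (sigma i)) ->
  (exists p, L2 p /\ subdifferential (@tv_norm R) u0 (Kpre k p)) ->
  (forall s x, is_sign s ->
    s * eta0 x = 1 <-> exists i, s = sigma i /\ x = x0 i) ->
  C2_torus eta0 ->
  (forall i, sigma i * torus_derive2 eta0 (x0 i) < 0) ->
  L2_linearly_independent (fun i => K k (sdirac 1 (x0 i))) ->
  exists2 eps0 : R, 0 < eps0 &
  forall eps : R, 0 < eps -> eps < eps0 ->
  exists alpha lambda0 : R, [/\ 0 < alpha, 0 < lambda0 &
  forall (lambda : R) (w : torus R -> R),
    noise_region alpha lambda0 (lambda, w) -> 0 < lambda ->
  exists u : radon R,
    [/\ primal_solution k y0 lambda w u,
        forall v, primal_solution k y0 lambda w v -> eq_radon v u &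
        exists! cx : ('I_n -> R) * ('I_n -> torus R),
          eq_radon u (dirac_comb cx.1 sigma cx.2) /\
          forall i,
            [/\ dirac_ball dB (sdirac (sigma i) (x0 i)) eps
                  (sdirac (sigma i) (cx.2 i)),
                sigma i * noisy_certificate k y0 lambda w (cx.2 i) = 1,
                0 < cx.1 i &
                `|cx.1 i - c0 i| <= eps]]].
Proof.
move=> kC2 dB_metric c0_gt0 sgn _ contact etaC2 curved free.
have freeA : L2_linearly_independent (fun i => atom k (x0 i)).
  suff -> : (fun i => atom k (x0 i)) = (fun i => K k (sdirac 1 (x0 i))) by [].
  have [B kb] := C2_torus_expansion kC2.
  apply/funext => i; apply/funext => s; rewrite /K cintegral_sdirac ?mul1r//.
  by apply: continuous_bounded_measurable; exact: (continuous_translate kb).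
have x0inj : injective x0.
  have [B kb] := C2_torus_expansion kC2.
  have [[r C] [/= r0 _ pert]] := perturbed_independence kb freeA.
  have shift0 : shift x0 (fun=> 0) = x0.
    by apply/funext => j; rewrite /shift torus_pi0 addr0.
  have := pert (fun=> 0); rewrite shift0 => H.
  apply: (certified_points_inj (k := k) (C := C)); apply: H => i.
  by rewrite normr0 ltW.
pose F i j := if i == j then 1 else dB (sdirac (sigma i) (x0 i)) (sdirac (sigma j) (x0 j)).
have F0 i j : 0 < F i j.
  rewrite /F; case: eqP => // ij; apply: sdirac_dist_gt0 => // /x0inj.
  exact: ij.
have /choice[m mP] : forall i, exists m, 0 < m /\ forall j, m <= F i j.
  by move=> i; have [m m0 mF] := positive_lower_bound (F0 i); exists m.
have [d d0 dm] := positive_lower_bound (fun i => (mP i).1).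
have dF i j : i != j -> d <= dB (sdirac (sigma i) (x0 i)) (sdirac (sigma j) (x0 j)).
  by move=> ij; have := le_trans (dm i) ((mP i).2 j); rewrite /F (negbTE ij).
(* balls of radius below half the smallest distance between spikes are disjoint *)
exists (d / 2); first by rewrite divr_gt0.
move=> eps eps0 epsd.
have /choice[rr rrP] : forall i, exists r, 0 < r /\ forall t, `|t| <= r ->
    dirac_ball dB (sdirac (sigma i) (x0 i)) eps (sdirac (sigma i) (x0 i + torus_pi t)).
  by move=> i; have [r r0 rP] := sdirac_ball dB_metric (x0 i) (sgn i) eps0; exists r.
have [rho rho0 rhoP] := positive_lower_bound (fun i => (rrP i).1).
have [alpha [lambda0 [alpha0 lambda00 rec]]] :=
  support_recovery kC2 c0_gt0 sgn contact etaC2 curved freeA eps0 rho0.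
exists alpha, lambda0; split => // lambda w region lambda_gt0.
have [c [t [ct xinj sigE extE [usol uuniq]]]] := rec lambda w region lambda_gt0.
pose x := shift x0 t; rewrite -/x in xinj sigE extE usol uuniq.
have xball i : dirac_ball dB (sdirac (sigma i) (x0 i)) eps (sdirac (sigma i) (x i)).
  by apply: (rrP i).2; apply: le_trans (rhoP i); have [] := ct i.
exists (dirac_comb c sigma x); split => //.
exists (c, x); split => /=.
  by split => // i; have [? ? _] := ct i.
move=> [c' x'] /= [uE props].
(* a contact point lies in one ball only, hence is attached to one index *)
have x'E : x' = x.
  apply/funext => i; have [b' s' _ _] := props i.
  have [j ij] : exists j, x' i = x j.
    by apply: extE; rewrite -[`|_|]mul1r -{1}(sign_norm (sgn i)) -normrM s' normr1.
  have [e|neq] := eqVneq i j; [by rewrite ij e|exfalso].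
  have sij : sigma i = sigma j.
    have := sigE j; rewrite -ij => sj; move: s' sj.
    by case: (sgn i) (sgn j) => -> [] -> //; lra.
  have [_ _ tri _] := dB_metric; have [_ dsym _ _] := dB_metric.
  have S y := signed_diracs_sdirac y (sgn i).
  have far := dF i j neq; have [_ bj] := xball j; have [_ bi] := b'.
  rewrite -sij in far bj; rewrite -ij in bj.
  have T := tri _ _ _ (S (x0 i)) (S (x' i)) (S (x0 j)).
  rewrite (dsym _ _ (S (x0 i)) (S (x' i))) in T.
  have := le_trans far (le_trans T (lerD bi bj)).
  by move: epsd; clear; lra.
rewrite x'E in uE props *; congr (_, _).
apply/funext => i.
have := uE _ (measurable_torus1 (x i)).
rewrite !dirac_combE (bigD1 i)//= [in RHS](bigD1 i)//=.
have z b : (\sum_(j < n | j != i) (b j * sigma j)%:E * \d_(x j) [set x i] = 0)%E.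
  apply: big1 => j ji; rewrite diracE memNset ?mule0//= => /xinj e.
  by rewrite e eqxx in ji.
rewrite !z !adde0 diracE mem_set// !mule1 => -[].
by case: (sgn i) => ->; [rewrite !mulr1|rewrite !mulrN1 => /oppr_inj].
Qed.
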